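(* Let $A=k[x,y]$ be a polynomial ring over an infinite field $k$. Let $a\le b<d$ be positive integers and let $$I=(x^d,y^d)+(x^{d-i}y^i\mid a\le i\le b).$$ Then $$\operatorname{reg}R(I)=\operatorname{reg}F(I)=r_J(I)$$ for any homogeneous minimal reduction $J$ of $I$.
   Context: Let $\mathfrak m=(x,y)$. $R(I)=\bigoplus_{n\ge 0}I^n$ is the Rees algebra (standard graded over $A$) and $F(I)=\bigoplus_{n\ge 0}I^n/\mathfrak mI^n$ is the fiber ring. An ideal $J\subseteq I$ is a reduction of $I$ if $I^{n+1}=JI^n$ for some $n\ge 0$; the least such $n$ is the reduction number $r_J(I)$; a reduction is minimal if it is minimal with respect to inclusion. For a standard graded algebra $R$ over a commutative ring, with $R_+$ the ideal generated by elements of positive degree, put $a_i(R)=\max\{n\mid H^i_{R_+}(R)_n\ne 0\}$ ($-\infty$ if $H^i_{R_+}(R)=0$) and $\operatorname{reg}R=\max\{a_i(R)+i\mid i\ge 0\}$. *)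

(* Defs.v *)
From HB Require Import structures.
From mathcomp Require Import all_boot all_order all_algebra.
From mathcomp Require Import boolp classical_sets cardinality.
From mathcomp Require Import mpoly ring.

Set Implicit Arguments.
Unset Strict Implicit.
Unset Printing Implicit Defensive.

Import Order.TTheory GRing.Theory Num.Theory.
Local Open Scope ring_scope.
Local Open Scope quotient_scope.
Local Open Scope classical_set_scope.

Section Ideals.
Variable A : comNzRingType.
Implicit Types (I J K S : set A) (x y : A).

Definition is_ideal K : Prop :=
  [/\ K 0, forall x y, K x -> K y -> K (x + y) & forall a x, K x -> K (a * x)].

Definition ideal_gen S : set A := smallest is_ideal S.

Definition ideal_mul I J : set A := ideal_gen [set x * y | x in I & y in J].

Definition ideal_pow I (n : nat) : set A := iter n (ideal_mul I) setT.

Lemma ideal_gen_ideal S : is_ideal (ideal_gen S).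
Proof.
split.
- by move=> K [[]].
- by move=> x y Sx Sy K [iK SK]; case: (iK) => _ aK _; apply: aK; [apply: Sx|apply: Sy].
- by move=> a x Sx K [iK SK]; case: (iK) => _ _ mK; apply: mK; apply: Sx.
Qed.

Lemma ideal_gen_sub S : S `<=` ideal_gen S.
Proof. exact: sub_smallest. Qed.

Lemma ideal_gen_min S K : is_ideal K -> S `<=` K -> ideal_gen S `<=` K.
Proof. by move=> iK SK x; apply. Qed.

Lemma ideal_pow_ideal I n : is_ideal (ideal_pow I n).
Proof. by case: n => [|n]; [split|exact: ideal_gen_ideal]. Qed.

Lemma idealN K x : is_ideal K -> K x -> K (- x).
Proof. by case=> _ _ mK Kx; rewrite -mulN1r; apply: mK. Qed.

Lemma idealB K x y : is_ideal K -> K x -> K y -> K (x - y).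
Proof. by move=> iK Kx Ky; case: (iK) => _ aK _; apply: aK => //; apply: idealN. Qed.

Lemma ideal_sum K (T : Type) (s : seq T) (P : pred T) (F : T -> A) :
  is_ideal K -> (forall i, P i -> K (F i)) -> K (\sum_(i <- s | P i) F i).
Proof. by case=> K0 aK _ KF; apply: big_ind. Qed.

Lemma ideal_mulP I J x y : I x -> J y -> ideal_mul I J (x * y).
Proof. by move=> Ix Jy; apply: ideal_gen_sub; exists x => //; exists y. Qed.

Lemma ideal_powM I m n x y :
  ideal_pow I m x -> ideal_pow I n y -> ideal_pow I (m + n) (x * y).
Proof.
move=> + Iy; elim: m x => [|m IH] x.
  by case: (ideal_pow_ideal I n) => _ _ mI _; apply: mI.
case: (ideal_pow_ideal I (m.+1 + n)) => I0 aI mI.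
apply: (@ideal_gen_min _ [set x | ideal_pow I (m.+1 + n) (x * y)]); first split => /=.
- by rewrite mul0r.
- by move=> u v Iu Iv; rewrite mulrDl; apply: aI.
- by move=> a u Iu; rewrite -mulrA; apply: mI.
by move=> _ [u Iu [v Iv <-]] /=; rewrite -mulrA; apply: ideal_mulP => //; apply: IH.
Qed.

Lemma ideal_mulMl I J K L x y :
  (forall u v, J u -> K v -> L (u * v)) ->
  is_ideal L -> ideal_mul I J x -> K y -> ideal_mul I L (x * y).
Proof.
move=> JKL iL + Ky.
case: (ideal_gen_ideal [set x * y | x in I & y in L]) => I0 aI mI.
apply: (@ideal_gen_min _ [set x | ideal_mul I L (x * y)]); first split => /=.
- by rewrite mul0r.
- by move=> u v Iu Iv; rewrite mulrDl; apply: aI.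
- by move=> a u Iu; rewrite -mulrA; apply: mI.
by move=> _ [u Iu [v Iv <-]] /=; rewrite -mulrA; apply: ideal_mulP => //; apply: JKL.
Qed.

Definition reduction J I : Prop :=
  [/\ is_ideal J, J `<=` I &
      exists n, ideal_pow I n.+1 = ideal_mul J (ideal_pow I n)].

Definition minimal_reduction J I : Prop :=
  reduction J I /\ forall K, reduction K I -> K `<=` J -> K = J.

Definition reduction_number J I (r : nat) : Prop :=
  ideal_pow I r.+1 = ideal_mul J (ideal_pow I r) /\
  forall n, ideal_pow I n.+1 = ideal_mul J (ideal_pow I n) -> (r <= n)%N.

End Ideals.

Section Graded.
Variable R : comNzRingType.

Definition graded (G : nat -> set R) : Prop :=
  [/\ forall n, G n 0 /\ (forall x y, G n x -> G n y -> G n (x - y)),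
      G 0%N 1 /\ (forall m n x y, G m x -> G n y -> G (m + n)%N (x * y)),
      forall x, exists N (c : nat -> R),
        (forall i, G i (c i)) /\ x = \sum_(i < N) c i
    & forall N (c : nat -> R), (forall i, G i (c i)) ->
        \sum_(i < N) c i = 0 -> forall i, (i < N)%N -> c i = 0].

(* Degree n.+1 is spanned additively by products of degrees 1 and n; by
   induction, R is generated by G 1 as an algebra over G 0. *)
Definition standard_graded (G : nat -> set R) : Prop :=
  graded G /\
  forall n x, G n.+1 x -> exists l : seq (R * R),
    (forall u, u \in l -> G 1%N u.1 /\ G n u.2) /\ x = \sum_(u <- l) u.1 * u.2.

End Graded.

Record stdGradedRing := StdGradedRing {
  sg_ring :> comNzRingType;
  sg_deg : nat -> set sg_ring;
  sg_degP : standard_graded sg_deg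
}.

(* The localization R_g = R[1/g]; the pair (r, k) represents r / g^k. *)
Section Localization.
Variables (R : comNzRingType) (g : R).
Implicit Types u v w : R * nat.

Definition loc_equiv u v : bool :=
  `[< exists l, g ^+ l * (u.1 * g ^+ v.2 - v.1 * g ^+ u.2) = 0 >].

Lemma loc_equiv_refl : reflexive loc_equiv.
Proof. by move=> u; apply/asboolP; exists 0%N; rewrite subrr mulr0. Qed.

Lemma loc_equiv_sym : ssrbool.symmetric loc_equiv.
Proof.
have H u v : loc_equiv u v -> loc_equiv v u.
  move=> /asboolP[l E]; apply/asboolP; exists l.
  by rewrite -opprB mulrN E oppr0.
by move=> u v; apply/idP/idP; apply: H.
Qed.

Lemma loc_equiv_trans : transitive loc_equiv.
Proof.
move=> [b j] [a i] [c k] /asboolP[l /= E] /asboolP[m /= F].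
apply/asboolP; exists (l + m + j)%N => /=.
have -> : g ^+ (l + m + j) * (a * g ^+ k - c * g ^+ i) =
  g ^+ (m + k) * (g ^+ l * (a * g ^+ j - b * g ^+ i)) +
  g ^+ (l + i) * (g ^+ m * (b * g ^+ k - c * g ^+ j)).
  by rewrite !exprD; ring.
by rewrite E F !mulr0 addr0.
Qed.

Canonical loc_equiv_equiv :=
  EquivRel loc_equiv loc_equiv_refl loc_equiv_sym loc_equiv_trans.

Definition loc := {eq_quot loc_equiv}.
HB.instance Definition _ := Choice.on loc.
HB.instance Definition _ := EqQuotient.on loc.

Definition frac (r : R) (k : nat) : loc := \pi_loc (r, k).

Lemma eq_frac r k s l :
  frac r k = frac s l <->
  exists m, g ^+ m * (r * g ^+ l - s * g ^+ k) = 0.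
Proof.
split; first by move=> /eqP; rewrite /frac eqmodE => /asboolP.
by move=> H; apply/eqP; rewrite /frac eqmodE; apply/asboolP.
Qed.

Lemma fracP (x : loc) : exists r k, x = frac r k.
Proof. by exists (repr x).1, (repr x).2; rewrite /frac -surjective_pairing reprK. Qed.

Definition loc_zero : loc := frac 0 0.
Definition loc_opp (x : loc) : loc := frac (- (repr x).1) (repr x).2.
Definition loc_add (x y : loc) : loc :=
  frac ((repr x).1 * g ^+ (repr y).2 + (repr y).1 * g ^+ (repr x).2)
       ((repr x).2 + (repr y).2).

Lemma repr_frac r k :
  exists m, g ^+ m * ((repr (frac r k)).1 * g ^+ k - r * g ^+ (repr (frac r k)).2) = 0.
Proof. by apply/eq_frac; rewrite /frac -surjective_pairing reprK. Qed.

Lemma loc_oppE r k : loc_opp (frac r k) = frac (- r) k.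
Proof.
have [m E] := repr_frac r k; apply/eq_frac; exists m.
by rewrite !mulNr -opprD mulrN E oppr0.
Qed.

Lemma loc_addE r k s l :
  loc_add (frac r k) (frac s l) = frac (r * g ^+ l + s * g ^+ k) (k + l).
Proof.
have [m E] := repr_frac r k; have [n F] := repr_frac s l.
rewrite /loc_add.
case: (repr (frac r k)) (repr (frac s l)) E F => [r' k'] [s' l'] /= E F.
apply/eq_frac; exists (m + n)%N.
have -> : g ^+ (m + n) * ((r' * g ^+ l' + s' * g ^+ k') * g ^+ (k + l) -
                          (r * g ^+ l + s * g ^+ k) * g ^+ (k' + l')) =
  g ^+ (n + l + l') * (g ^+ m * (r' * g ^+ k - r * g ^+ k')) +
  g ^+ (m + k + k') * (g ^+ n * (s' * g ^+ l - s * g ^+ l')).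
  by rewrite !exprD; ring.
by rewrite E F !mulr0 addr0.
Qed.

Lemma loc_addA : associative loc_add.
Proof.
move=> x y z; have [r [k ->]] := fracP x; have [s [l ->]] := fracP y.
have [t [m ->]] := fracP z; rewrite !loc_addE addnA; congr frac.
by rewrite !exprD; ring.
Qed.

Lemma loc_addC : commutative loc_add.
Proof. by move=> x y; rewrite /loc_add addrC addnC. Qed.

Lemma loc_add0 : left_id loc_zero loc_add.
Proof.
move=> x; have [r [k ->]] := fracP x; rewrite loc_addE; congr frac.
by rewrite expr0; ring.
Qed.

Lemma loc_addN : left_inverse loc_zero loc_opp loc_add.
Proof.
move=> x; have [r [k ->]] := fracP x; rewrite loc_oppE loc_addE.
by apply/eq_frac; exists 0%N; ring.
Qed.

HB.instance Definition _ :=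
  GRing.isZmodule.Build loc loc_addA loc_addC loc_add0 loc_addN.

Lemma fracD r k s l :
  frac r k + frac s l = frac (r * g ^+ l + s * g ^+ k) (k + l).
Proof. exact: loc_addE. Qed.

Lemma fracN r k : - frac r k = frac (- r) k.
Proof. exact: loc_oppE. Qed.

Lemma frac0 : 0 = frac 0 0.
Proof. by []. Qed.

End Localization.

(* The canonical map R_g -> R_(g h), r / g^k |-> r h^k / (g h)^k; it is only
   meaningful when g' = g * h (see loc_res_frac). *)
Definition loc_res (R : comNzRingType) (g g' h : R) (x : loc g) : loc g' :=
  frac g' ((repr x).1 * h ^+ (repr x).2) (repr x).2.

Lemma loc_res_frac (R : comNzRingType) (g g' h : R) r k :
  g' = g * h -> loc_res g' h (frac g r k) = frac g' (r * h ^+ k) k.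
Proof.
move=> ->; have [m E] := repr_frac g r k; rewrite /loc_res.
case: (repr (frac g r k)) E => [r' k'] /= E.
apply/eq_frac; exists m.
have -> : (g * h) ^+ m * (r' * h ^+ k' * (g * h) ^+ k - r * h ^+ k * (g * h) ^+ k') =
  h ^+ (m + k + k') * (g ^+ m * (r' * g ^+ k - r * g ^+ k')).
  by rewrite !exprMn !exprD; ring.
by rewrite E mulr0.
Qed.

Section LocalCohomology.
Variable R : stdGradedRing.

Definition irrelevant_ideal : set R :=
  ideal_gen [set x | exists2 n, (0 < n)%N & sg_deg n x].

Definition degZ (n : int) : set R :=
  match n with Posz m => sg_deg m | Negz _ => [set 0] end.

(* The degree-n part of R_g, for g homogeneous of degree e. *)
Definition loc_deg (g : R) (e : nat) (n : int) : set (loc g) :=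
  [set x | exists r k, degZ (n + (k * e)%N%:Z) r /\ x = frac g r k].

Section Cech.
Variables (m : nat) (f : 'I_m -> R).

Definition prodf (S : {set 'I_m}) : R := \prod_(j in S) f j.

(* A family indexed by all subsets; in cohomological degree i only its values
   at the S with #|S| = i are used. *)
Definition cochain := forall S : {set 'I_m}, loc (prodf S).

Definition cech_d (c : cochain) (T : {set 'I_m}) : loc (prodf T) :=
  \sum_(j in T)
    loc_res (prodf T) (f j) (c (T :\ j)) *~ (-1) ^+ #|[pred l in T | (l < j)%N]|.

(* The f j all have degree 1, so that prodf S has degree #|S|. *)
Definition cochain_deg (i : nat) (n : int) (c : cochain) : Prop :=
  forall S : {set 'I_m}, #|S| = i -> loc_deg #|S| n (c S).

Definition cocycle (i : nat) (c : cochain) : Prop :=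
  forall T : {set 'I_m}, #|T| = i.+1 -> cech_d c T = 0.

(* For i = 0 the condition on b is void and cech_d b set0 = 0. *)
Definition coboundary (i : nat) (n : int) (c : cochain) : Prop :=
  exists b : cochain, (forall j, j.+1 = i -> cochain_deg j n b) /\
    forall S : {set 'I_m}, #|S| = i -> c S = cech_d b S.

Definition cech_cohomology_neq0 (i : nat) (n : int) : Prop :=
  exists c, [/\ cochain_deg i n c, cocycle i c & ~ coboundary i n c].

Definition degree1_generators : Prop :=
  (forall j, sg_deg 1 (f j)) /\ ideal_gen (range f) = irrelevant_ideal.

End Cech.

(* H^i_{R_+}(R)_n <> 0, the local cohomology being that of the Cech complex on
   a finite sequence of degree-1 generators of R_+; up to isomorphism it does
   not depend on the sequence. *)
Definition local_cohomology_neq0 (i : nat) (n : int) : Prop :=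
  exists m (f : 'I_m -> R), degree1_generators f /\ cech_cohomology_neq0 f i n.

(* a_i(R), where None stands for -oo. *)
Definition a_invariant (i : nat) (a : option int) : Prop :=
  match a with
  | Some n => local_cohomology_neq0 i n /\
              forall n', local_cohomology_neq0 i n' -> n' <= n
  | None => forall n, ~ local_cohomology_neq0 i n
  end.

(* reg R = r; in particular all the a_i(R) and the maximum exist. *)
Definition regularity (r : int) : Prop :=
  exists a : nat -> option int,
    [/\ forall i, a_invariant i (a i),
        exists i n, a i = Some n /\ n + i%:Z = r
      & forall i n, a i = Some n -> n + i%:Z <= r].

End LocalCohomology.

Section Rees.
Variables (A : comNzRingType) (I : set A).

(* R(I) is realised as the subring of A[t] of polynomials whose coefficient of
   t^n lies in I^n. *)
Definition rees_pred : {pred {poly A}} :=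
  fun p => `[< forall n, ideal_pow I n p`_n >].

Lemma rees_subring : subring_closed rees_pred.
Proof.
split.
- apply/asboolP => n; rewrite coef1; case: n => [|n] //=.
  by case: (ideal_pow_ideal I n.+1).
- move=> p q /asboolP Ip /asboolP Iq; apply/asboolP => n; rewrite coefB.
  by apply: idealB => //; apply: ideal_pow_ideal.
- move=> p q /asboolP Ip /asboolP Iq; apply/asboolP => n; rewrite coefM.
  apply: ideal_sum => [|i _]; first exact: ideal_pow_ideal.
  have {1}-> : n = (i + (n - i))%N by rewrite subnKC // -ltnS.
  exact: ideal_powM.
Qed.

HB.instance Definition _ :=
  GRing.isSubringClosed.Build {poly A} rees_pred rees_subring.

Record rees := Rees { rees_poly : {poly A}; _ : rees_poly \in rees_pred }.

HB.instance Definition _ := [isSub for rees_poly].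
HB.instance Definition _ := [Choice of rees by <:].
HB.instance Definition _ := [SubChoice_isSubComNzRing of rees by <:].

HB.instance Definition _ := GRing.RMorphism.copy rees_poly (val : rees -> {poly A}).

Lemma reesP (p : rees) n : ideal_pow I n (rees_poly p)`_n.
Proof. by case: p => p /= /asboolP. Qed.

Definition rees_deg (n : nat) : set rees :=
  [set p | exists a, rees_poly p = a *: 'X^n].

End Rees.

Section ReesGraded.
Variables (A : comNzRingType) (I : set A).

Lemma rees_deg_standard : standard_graded (@rees_deg A I).
Proof.
have ring_deg n (p : rees I) : rees_deg n p <-> forall i, i != n -> (rees_poly p)`_i = 0.
  split=> [[a ->] i ne|H]; first by rewrite coefZ coefXn (negPf ne) mulr0.
  exists (rees_poly p)`_n; apply/polyP => i; rewrite coefZ coefXn.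
  by have [->|/H ->] := eqVneq i n; rewrite (mulr1, mulr0).
have mono n a : ideal_pow I n a -> a *: 'X^n \in rees_pred I.
  move=> Ia; apply/asboolP => i; rewrite coefZ coefXn.
  have [->|_] := eqVneq i n; rewrite ?mulr1 // mulr0.
  by case: (ideal_pow_ideal I i).
split; first split.
- move=> n; split=> [|p q [a E] [b F]]; first by exists 0; rewrite raddf0 scale0r.
  by exists (a - b); rewrite raddfB /= E F scalerBl.
- split=> [|m n p q [a E] [b F]]; first by exists 1; rewrite rmorph1 expr0 scale1r.
  by exists (a * b); rewrite rmorphM /= E F exprD -scalerAl -scalerAr scalerA.
- move=> p; exists (size (rees_poly p)).
  exists (fun n => Rees (mono n _ (reesP p n))); split=> [i|]; first by eexists.
  apply: val_inj; rewrite /= raddf_sum /= -[LHS]coefK poly_def.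
  by apply: eq_bigr.
- move=> N c cd E i iN; apply: val_inj; rewrite /=.
  have /(congr1 (fun p : rees I => (rees_poly p)`_i)) := E.
  rewrite raddf0 coef0 raddf_sum coef_sum (bigD1 (Ordinal iN)) //= big1 ?addr0.
    move=> ci; apply/polyP => j; rewrite coef0.
    by have [->//|] := eqVneq j i; apply: (ring_deg i (c i)).1.
  by move=> j ji; apply: (ring_deg _ _).1 (cd j) _ _; rewrite eq_sym.
- move=> n p [a E].
  have : ideal_pow I n.+1 a by have := reesP p n.+1; rewrite E coefZ coefXn eqxx mulr1.
  move=> Ia; suff [l [lP El]] : exists l : seq (rees I * rees I),
      (forall u, u \in l -> rees_deg 1 u.1 /\ rees_deg n u.2) /\
      a *: 'X^(n.+1) = rees_poly (\sum_(u <- l) u.1 * u.2).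
    by exists l; split=> //; apply: val_inj; rewrite /= -El.
  move: a Ia {E}; apply: ideal_gen_min.
    split => /=.
    + by exists [::]; split=> //; rewrite big_nil scale0r raddf0.
    + move=> x y [l [lP El]] [l' [lP' El']]; exists (l ++ l'); split=> [u|].
        by rewrite mem_cat => /orP[/lP|/lP'].
      by rewrite big_cat raddfD /= -El -El' scalerDl.
    + move=> c x [l [lP El]].
      have cI : c *: 'X^0 \in rees_pred I by apply: mono.
      exists [seq (Rees cI * u.1, u.2) | u <- l]; split=> [u /mapP[v /lP[[v1 E1] v2] ->]|].
        split=> //=; exists (c * v1).
        by rewrite rmorphM /= E1 expr0 -scalerAl mul1r scalerA.
      rewrite big_map -scalerA El.
      have -> : \sum_(u <- l) Rees cI * u.1 * u.2 = Rees cI * \sum_(u <- l) u.1 * u.2.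
        by rewrite mulr_sumr; apply: eq_bigr => u _; rewrite mulrA.
      by rewrite rmorphM /= expr0 -scalerAl mul1r.
  move=> _ [x Ix [y Iy <-]] /=.
  have x1 : ideal_pow I 1 x.
    by rewrite -[x]mulr1; apply: ideal_mulP.
  exists [:: (Rees (mono 1%N x x1), Rees (mono n y Iy))]; split=> [u|].
    by rewrite inE => /eqP ->; split; eexists.
  by rewrite big_seq1 rmorphM /= -scalerAl -scalerAr scalerA -exprS.
Qed.

Definition rees_algebra : stdGradedRing := StdGradedRing rees_deg_standard.

End ReesGraded.

Section Fiber.
Variable k : fieldType.
Local Notation A := {mpoly k[2]}.
Variable I : set A.

Definition max_ideal : set A := ideal_gen [set 'X_ord0; 'X_ord_max].

Lemma max_ideal1 : ~ max_ideal 1.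
Proof.
suff H : max_ideal `<=` [set p : A | p.@[fun=> 0] = 0].
  by move/H => /= /eqP; rewrite mevalC oner_eq0.
apply: ideal_gen_min; first split => /=.
- by rewrite meval0.
- by move=> x y x0 y0; rewrite mevalD x0 y0 addr0.
- by move=> a x x0; rewrite mevalM x0 mulr0.
by move=> _ [] -> /=; rewrite mevalXU.
Qed.

(* F(I) is the quotient of R(I) by the ideal of elements whose coefficient of
   t^n lies in m I^n. *)
Definition fiber_pred : {pred rees I} :=
  fun p => `[< forall n, ideal_mul max_ideal (ideal_pow I n) (rees_poly p)`_n >].

Lemma fiber_idealr : idealr_closed fiber_pred.
Proof.
have iI n := ideal_gen_ideal [set x * y | x in max_ideal & y in ideal_pow I n].
split.
- apply/asboolP => n; rewrite raddf0 coef0; by case: (iI n).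
- apply/negP => /asboolP /(_ 0%N); rewrite rmorph1 coef1 /= => m1.
  apply: max_ideal1; move: m1; apply: ideal_gen_min; first exact: ideal_gen_ideal.
  move=> _ [x mx [y _ <-]]; rewrite mulrC.
  by case: (ideal_gen_ideal [set 'X_ord0; 'X_ord_max : A]) => _ _; apply.
- move=> r p q /asboolP mp /asboolP mq; apply/asboolP => n.
  have -> : rees_poly (r * p + q) = rees_poly p * rees_poly r + rees_poly q.
    by rewrite mulrC.
  rewrite coefD coefM; case: (iI n) => _ aI _.
  refine (aI _ _ _ (mq n)); apply: ideal_sum => [|i _]; first exact: iI.
  have e : n = (i + (n - i))%N by rewrite subnKC // -ltnS.
  have IM u v : ideal_pow I i u -> ideal_pow I (n - i) v -> ideal_pow I n (u * v).
    by move=> Iu Iv; rewrite e; apply: ideal_powM.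
  exact: ideal_mulMl IM (ideal_pow_ideal I n) (mp i) (reesP r (n - i)).
Qed.

HB.instance Definition _ := isIdealr.Build (rees I) fiber_pred fiber_idealr.

Definition fiber := {ideal_quot fiber_pred}.
HB.instance Definition _ := GRing.ComNzRing.on fiber.

Definition fiber_proj (p : rees I) : fiber := \pi_fiber p.
HB.instance Definition _ := GRing.RMorphism.copy fiber_proj \pi_fiber.

Lemma fiber_proj_surj (x : fiber) : exists p, x = fiber_proj p.
Proof. by exists (repr x); rewrite /fiber_proj reprK. Qed.

Lemma fiber_proj_eq0 (p : rees I) : fiber_proj p = 0 <-> p \in fiber_pred.
Proof.
have -> : (p \in fiber_pred) = (p == 0 %[mod fiber]) by rewrite -[RHS]Quotient.idealrBE subr0.
by rewrite -[0 in X in X <-> _](rmorph0 fiber_proj); split=> [/eqP|/eqP].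
Qed.

Definition fiber_deg (n : nat) : set fiber := [set fiber_proj p | p in @rees_deg _ I n].

End Fiber.

Section FiberGraded.
Variables (k : fieldType) (I : set {mpoly k[2]}).

Lemma fiber_deg_standard : standard_graded (@fiber_deg k I).
Proof.
have [[dB [d1 dM] dD _] dG] := rees_deg_standard I.
have deg0 n : fiber_deg n (0 : fiber I).
  by exists 0; [case: (dB n)|rewrite raddf0].
split; first split.
- move=> n; split=> // _ _ [p dp <-] [q dq <-].
  by exists (p - q); [case: (dB n) => _; apply|rewrite raddfB].
- split=> [|m n _ _ [p dp <-] [q dq <-]]; first by exists 1; rewrite ?rmorph1.
  by exists (p * q); [apply: dM|rewrite rmorphM].
- move=> x; have [p ->] := fiber_proj_surj x; have [N [c [cd ->]]] := dD p.
  exists N, (fun i => fiber_proj (c i)); split=> [i|]; first by exists (c i).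
  exact: raddf_sum.
- move=> N c cd; have /choice[p pP] : forall i, exists p, rees_deg i p /\ fiber_proj p = c i.
    by move=> i; have [p dp <-] := cd i; exists p.
  under eq_bigr do rewrite -(pP _).2.
  rewrite -raddf_sum => /fiber_proj_eq0/asboolP E i iN; rewrite -(pP i).2.
  apply/fiber_proj_eq0/asboolP => n.
  have [[a Ea] _] := pP i; rewrite Ea coefZ coefXn.
  have [->|_] := eqVneq n i; last by rewrite mulr0; case: (ideal_gen_ideal
    [set x * y | x in @max_ideal k & y in ideal_pow I n]).
  have := E i; rewrite raddf_sum coef_sum (bigD1 (Ordinal iN)) //= big1 ?addr0.
    by rewrite Ea coefZ coefXn eqxx.
  move=> j ji; have [[b ->] _] := pP j; rewrite coefZ coefXn.
  by rewrite eq_sym (negPf ji : (j == i :> nat) = false) mulr0.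
- move=> n _ [p dp <-]; have [l [lP ->]] := dG n p dp.
  exists [seq (fiber_proj u.1, fiber_proj u.2) | u <- l]; split.
    by move=> u /mapP[v /lP[v1 v2] ->]; split; [exists v.1|exists v.2].
  rewrite big_map raddf_sum; apply: eq_bigr => u _; exact: rmorphM.
Qed.

Definition fiber_ring : stdGradedRing := StdGradedRing fiber_deg_standard.

End FiberGraded.

Definition homogeneous_ideal (k : fieldType) (J : set {mpoly k[2]}) : Prop :=
  exists2 S : set {mpoly k[2]},
    (forall p, S p -> exists e, p \is e.-homog) & J = ideal_gen S.

(* (x^d, y^d) + (x^(d-i) y^i | a <= i <= b) *)
Definition monomial_ideal (k : fieldType) (d a b : nat) : set {mpoly k[2]} :=
  let x : {mpoly k[2]} := 'X_ord0 in
  let y : {mpoly k[2]} := 'X_ord_max in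
  ideal_gen ([set x ^+ d; y ^+ d] `|`
             [set x ^+ (d - i) * y ^+ i | i in [set i | (a <= i <= b)%N]]).

(* Main.v *)
From HB Require Import structures.
Require Import Defs.
From mathcomp Require Import all_boot all_order all_algebra.
From mathcomp Require Import boolp classical_sets cardinality.
From mathcomp Require Import mpoly ring zify.

(** Write u = x^d t and v = y^d t for these elements of the Rees algebra, S for
    the set of exponents {0, d} together with the interval [a, b], and nS for its
    n-fold sumset. Since I is generated by the monomials x^(d-s) y^s, s in S, a
    monomial lies in I^n exactly when some x^(nd-s) y^s, s in nS, divides it,
    and the degree-n part F_n of the fiber ring becomes, with x = 1 and y = T,
    the span of the T^s, s in nS.

    The shape of S makes both algebras as good as possible: if x^d m and y^d m
    are monomials of I^(n+1), then m lies in I^n ([in_pow_descent]). Hence u, v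
    is a regular sequence on the fiber ring, and also on the Rees algebra as far
    as elements of positive degree are concerned ([xy_descent]): the fiber ring
    is Cohen-Macaulay, and the first local cohomology of the Rees algebra is
    concentrated in negative degrees.

    For a standard graded domain R with such a pair u, v, let r > 0 be the least
    integer such that R_(n+1) = u R_n + v R_n for all n >= r. Then the regularity
    is r ([regularity_of_parameters]): H^i_n vanishes for n + i > r, and H^2 is
    nonzero in degree r - 2. The local cohomology may be that of the Cech complex
    on any sequence f of generators of R_+, possibly with zero members. After
    inverting u, v or u v this complex is exact, because the members of f then
    generate the unit ideal ([cech_exact]). So a cocycle is a coboundary over R_u
    and over R_v, and patching the two primitives meets no other obstruction than
    the cohomology of u, v itself: R_u and R_v intersect in R in degrees n >= 0,
    and R_uv = R_u + R_v in degrees n >= r - 1, but not in degree r - 2. All of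
    this takes place inside the fraction field. For the Rees algebra and for the
    fiber ring, R_(n+1) = u R_n + v R_n is the same property of sumsets, called
    [reducing] below, so they have the same regularity r.

    It remains to see that r is the reduction number of every homogeneous minimal
    reduction J. The part of J in degree d has no common zero on the projective
    line; k being infinite, it contains two coprime forms f and g, one of which
    involves y^d ([parameters_in_reduction]). Looking at the lowest and at the
    highest exponent of c, one sees that f c and g c can only lie in F_(n+1) when
    c lies in F_n ([inF_descent]). Therefore f F_n and g F_n meet in f g F_(n-1),
    and the dimension of f F_n + g F_n is 2 dim F_n - dim F_(n-1), whatever f and
    g are ([span_dim]). Thus F_(n+1) = f F_n + g F_n for the same n as for the
    pair y^d, x^d. In particular (f, g) is itself a reduction, so that J = (f, g)
    by minimality, and r is its reduction number ([minimal_reduction_reducing]). *)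

Set Implicit Arguments.
Unset Strict Implicit.
Unset Printing Implicit Defensive.

Import Order.TTheory GRing.Theory Num.Theory.
Local Open Scope ring_scope.

(** * Alternating cochains *)

Section AlternatingCochains.
Variables (K : comNzRingType) (m : nat).
Implicit Types (c b : {set 'I_m} -> K) (S T : {set 'I_m}) (i j : 'I_m).

Definition nbelow j T := #|[pred l in T | (l < j)%N]|.

(** The alternating (Cech) differential, for cochains indexed by all subsets. *)
Definition altd c T : K := \sum_(j in T) (-1) ^+ nbelow j T * c (T :\ j).

Lemma nbelowD1 i j T : i \in T -> nbelow j T = ((i < j) + nbelow j (T :\ i))%N.
Proof.
move=> iT; rewrite /nbelow (cardD1 i) inE iT /=; congr addn.
by apply: eq_card => l; rewrite !inE andbA.
Qed.

(** Removing i shifts the position of j only when i < j, so exactly one of the two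
    positions changes with the order of removal. *)
Lemma sign_swap T i j : i \in T -> j \in T -> i != j ->
  (-1) ^+ nbelow j T * (-1) ^+ nbelow i (T :\ j) =
  - ((-1) ^+ nbelow i T * (-1) ^+ nbelow j (T :\ i)) :> K.
Proof.
move=> iT jT ij; rewrite (nbelowD1 j iT) (nbelowD1 i jT).
move: ij; rewrite -(inj_eq val_inj) /=; case: ltngtP => // _ _;
  rewrite !exprD expr0 expr1; ring.
Qed.

Lemma altdB c b T : altd (fun S => c S - b S) T = altd c T - altd b T.
Proof. by rewrite /altd -sumrB; apply: eq_bigr => j _; rewrite mulrBr. Qed.

Lemma eq_altd c b T : (forall j, j \in T -> c (T :\ j) = b (T :\ j)) ->
  altd c T = altd b T.
Proof. by move=> e; apply: eq_bigr => j jT; rewrite e. Qed.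

Lemma altd1 c j : altd c [set j] = c finset.set0.
Proof.
rewrite /altd big_set1 finset.setDv.
have /eqP -> : nbelow j [set j] == 0%N.
  rewrite -leqn0 leqNgt; apply/negP => /card_gt0P[l]; rewrite !inE.
  by case/andP=> /eqP ->; rewrite ltnn.
by rewrite expr0 mul1r.
Qed.

Lemma altd_altd c T : altd (altd c) T = 0.
Proof.
(* The terms for (j, i) and (i, j) cancel. *)
pose G j i := if (i \in T) && (j \in T) && (i != j) then
  (-1) ^+ nbelow j T * ((-1) ^+ nbelow i (T :\ j) * c (T :\ j :\ i)) else 0.
have -> : altd (altd c) T = \sum_j \sum_i G j i.
  rewrite /altd big_mkcond; apply: eq_bigr => j _.
  have [jT|jT] := boolP (j \in T); last first.
    by rewrite big1 // => i _; rewrite /G (negPf jT) andbF.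
  rewrite big_distrr big_mkcond /=; apply: eq_bigr => i _.
  by rewrite /G jT !inE andbT andbC; case: ifP.
have Gn j i : G j i = - G i j.
  rewrite /G (andbC (i \in T)) (eq_sym i); case: ifP => [/andP[/andP[jT iT] ji]|]; last by rewrite oppr0.
  rewrite !mulrA sign_swap // 1?eq_sym // !mulNr; congr (- (_ * c _)).
  by rewrite !finset.setDDl finset.setUC.
have G0 j : G j j = 0 by rewrite /G eqxx andbF.
have split j : \sum_i G j i = \sum_(i < m | (i < j)%N) G j i + \sum_(i < m | (j < i)%N) G j i.
  rewrite (bigID (fun i : 'I_m => (i < j)%N)) /=; congr (_ + _).
  rewrite (bigD1 j) ?ltnn //= G0 add0r; apply: eq_bigl => i.
  by rewrite -leqNgt ltn_neqAle andbC eq_sym.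
rewrite (eq_bigr _ (fun j _ => split j)) big_split /=.
rewrite (exchange_big_dep predT) //= -big_split /= big1 // => i _.
rewrite -big_split /= big1 // => j _; by rewrite Gn addNr.
Qed.

(** Contracting homotopy: inserting a fixed index contracts the complex, and w
    averages over the index. The weights allow to clear denominators. *)
Definition althom (w : 'I_m -> K) c S : K :=
  \sum_(j in ~: S) (-1) ^+ nbelow j S * (w j * c (j |: S)).

Lemma setU1D1 S i j : i != j -> (j |: S) :\ i = j |: (S :\ i).
Proof.
move=> ij; apply/setP => l; rewrite !inE.
by case: eqVneq => [->|] //=; case: eqVneq => [e|//]; rewrite e eqxx in ij.
Qed.

Lemma nbelowU1 S j : j \notin S -> nbelow j (j |: S) = nbelow j S.
Proof. by move=> jS; rewrite (@nbelowD1 j) ?finset.setU11 // ltnn setU1K. Qed.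

Lemma sign_swapU S i j : i \in S -> j \notin S ->
  (-1) ^+ nbelow i S * (-1) ^+ nbelow j (S :\ i) =
  - ((-1) ^+ nbelow j S * (-1) ^+ nbelow i (j |: S)) :> K.
Proof.
move=> iS jS; have ij : i != j by apply: contraNneq jS => <-.
have := @sign_swap (j |: S) i j; rewrite !inE iS eqxx orbT => /(_ isT isT ij).
rewrite setU1K // setU1D1 // !nbelowU1 ?inE ?(negPf jS) ?andbF //.
have sq n : (-1) ^+ n * (-1) ^+ n = 1 :> K by rewrite -expr2 sqrr_sign.
set s1 := (-1) ^+ nbelow j S; set s2 := (-1) ^+ nbelow i S.
set s3 := (-1) ^+ nbelow i _; set s4 := (-1) ^+ nbelow j _ => E.
transitivity (s1 * (s1 * s2) * s4); first by rewrite mulrA sq mul1r.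
by rewrite E -!mulrA mulNr mulrN -(mulrA s3) sq mulr1.
Qed.

Lemma althomK (w : 'I_m -> K) c S :
  \sum_j w j = 1 ->
  (forall j, j \notin S -> w j * altd c (j |: S) = 0) ->
  altd (althom w c) S = c S.
Proof.
move=> w1 cc.
transitivity (\sum_(i in S) (w i * c S + \sum_(j in ~: S)
   (-1) ^+ nbelow i S * ((-1) ^+ nbelow j (S :\ i) * (w j * c (j |: (S :\ i)))))).
  apply: eq_bigr => i iS; rewrite /althom (bigD1 i) ?inE ?eqxx //= finset.setD1K //.
  have /eqP -> : nbelow i (S :\ i) == nbelow i S by rewrite [in X in _ == X](nbelowD1 i iS) ltnn.
  rewrite mulrDr mulrA -expr2 sqrr_sign mul1r mulr_sumr; congr (_ + _).
  apply: eq_bigl => j; rewrite !inE negb_and negbK andbC.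
  by case: eqVneq => [->|] //=; rewrite iS.
rewrite big_split exchange_big /=.
rewrite [X in _ + X](eq_bigr (fun j => w j * c S)) => [|j]; last first.
  rewrite inE => jS; have := cc j jS.
  rewrite /altd big_setU1 //= setU1K // nbelowU1 // mulrDr mulrCA => /eqP.
  rewrite addr_eq0 => /eqP E.
  have -> : w j * c S = (-1) ^+ nbelow j S * ((-1) ^+ nbelow j S * (w j * c S)).
    by rewrite mulrA -expr2 sqrr_sign mul1r.
  rewrite E mulrN -mulNr !mulr_sumr; apply: eq_bigr => i iS.
  rewrite mulrA sign_swapU // setU1D1; last by apply: contraNneq jS => <-.
  ring.
rewrite -!mulr_suml -[RHS]mul1r -w1 [in RHS](bigID (mem S)) /= -mulrDl.
by congr ((_ + _) * _); apply: eq_bigl => j; rewrite inE.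
Qed.
End AlternatingCochains.

(** * Graded pieces and generators *)

Section GradedPieces.
Variable R : stdGradedRing.

Lemma sg_deg0 n : sg_deg n (0 : R).
Proof. by have [[h _ _ _] _] := sg_degP R; case: (h n). Qed.

Lemma sg_degB n (x y : R) : sg_deg n x -> sg_deg n y -> sg_deg n (x - y).
Proof. by have [[h _ _ _] _] := sg_degP R; case: (h n) => _; apply. Qed.

Lemma sg_degN n (x : R) : sg_deg n x -> sg_deg n (- x).
Proof. by move=> xn; rewrite -sub0r; apply/sg_degB/xn/sg_deg0. Qed.

Lemma sg_degD n (x y : R) : sg_deg n x -> sg_deg n y -> sg_deg n (x + y).
Proof. by move=> xn yn; rewrite -[y]opprK; apply/sg_degB/sg_degN. Qed.

Lemma sg_deg1 : sg_deg 0 (1 : R).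
Proof. by have [[_ [h _] _ _] _] := sg_degP R. Qed.

Lemma sg_degM p n (x y : R) : sg_deg p x -> sg_deg n y -> sg_deg (p + n) (x * y).
Proof. by have [[_ [_ h] _ _] _] := sg_degP R; apply: h. Qed.

Lemma sg_degX e (x : R) n : sg_deg e x -> sg_deg (n * e) (x ^+ n).
Proof.
move=> xe; elim: n => [|n IH]; first by rewrite mul0n expr0; apply: sg_deg1.
by rewrite exprS mulSn; apply: sg_degM.
Qed.

Lemma sg_deg_sum n (T : Type) (s : seq T) (P : pred T) (F : T -> R) :
  (forall i, P i -> sg_deg n (F i)) -> sg_deg n (\sum_(i <- s | P i) F i).
Proof. by move=> h; apply: big_ind => //; [exact: sg_deg0|exact: sg_degD]. Qed.

Lemma sg_deg_prod m (f : 'I_m -> R) (S : {set 'I_m}) :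
  (forall j, sg_deg 1 (f j)) -> sg_deg #|S| (prodf f S).
Proof.
move=> f1; rewrite /prodf -sum1_card.
by apply: (big_ind2 (fun n (x : R) => sg_deg n x)); [exact: sg_deg1| move=> *; apply: sg_degM|].
Qed.

(** Decompositions can be padded with zeros, so that finitely many elements
    have decompositions of the same length. *)
Lemma homogeneous_decomposition (x : R) : exists N (c : nat -> R),
  (forall i, sg_deg i (c i)) /\ forall N', (N <= N')%N -> x = \sum_(i < N') c i.
Proof.
have [[_ _ h _] _] := sg_degP R; have [N [c [ci ->]]] := h x.
exists N, (fun i => if (i < N)%N then c i else 0); split.
  by move=> i; case: ifP => // _; apply: sg_deg0.
move=> N' NN'; rewrite (big_ord_widen N' c NN') big_mkcond /=.
by apply: eq_bigr => i _; case: ifP.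
Qed.

Lemma homogeneous_unique N (c : nat -> R) : (forall i, sg_deg i (c i)) ->
  \sum_(i < N) c i = 0 -> forall i, (i < N)%N -> c i = 0.
Proof. by have [[_ _ _ h] _] := sg_degP R; apply: h. Qed.

Lemma degZ0 n : degZ n (0 : R).
Proof. by case: n => n //=; apply: sg_deg0. Qed.

Lemma degZN n (x : R) : degZ n x -> degZ n (- x).
Proof. by case: n => n /=; [apply: sg_degN | move=> ->; rewrite oppr0]. Qed.

Lemma degZD n (x y : R) : degZ n x -> degZ n y -> degZ n (x + y).
Proof. by case: n => n /=; [apply: sg_degD | move=> -> ->; rewrite addr0]. Qed.

Lemma degZM n p (x y : R) : degZ n x -> sg_deg p y -> degZ (n + p%:Z) (x * y).
Proof.
case: n => n; first exact: (@sg_degM n p).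
by move=> /= -> _; rewrite mul0r; apply: degZ0.
Qed.

Section PowersOfGenerators.
Variables (T : finType) (f : T -> R) (n0 : nat).
Hypothesis f_deg1 : forall j, sg_deg 1 (f j).
Hypothesis f_gen : forall n (x : R), (n0 <= n)%N -> sg_deg n.+1 x ->
  exists2 a : T -> R, forall j, sg_deg n (a j) & x = \sum_j f j * a j.

(** Pigeonhole: a monomial in the f j of large degree is divisible by one of
    the powers f j ^+ e j. The bound is the best possible, which matters for
    the position of the top local cohomology. The coefficient a j is zero when
    its degree is negative. *)
Lemma degree_in_powers (e : T -> nat) l (x : R) :
  (n0 + \sum_j (e j).-1 < l)%N || [exists j, e j == 0%N] -> sg_deg l x ->
  exists2 a : T -> R, forall j, degZ (l%:Z - (e j)%:Z) (a j) &
    x = \sum_j f j ^+ e j * a j.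
Proof.
elim: l e x => [|l IH] e x hl xl; have [j0 /eqP ej0|epos] := pickP (fun j => e j == 0%N).
1,3: exists (fun j => if j == j0 then x else 0) => [j|];
  [by case: eqP => [->|_]; [rewrite ej0 subr0 | exact: degZ0]
  |by rewrite (bigD1 j0) //= eqxx ej0 expr0 mul1r big1 ?addr0 // => j /negPf ->; rewrite mulr0].
  by move: hl; rewrite ltn0 => /existsP[j]; rewrite epos.
have {}hl : (n0 + \sum_j (e j).-1 < l.+1)%N.
  by case/orP: hl => // /existsP[j]; rewrite epos.
have [|y yl ->] := f_gen _ xl; first by lia.
pose e' j i := if i == j then (e i).-1 else e i.
have /choice[a Ha] : forall j, exists a : T -> R,
    (forall i, degZ (l%:Z - (e' j i)%:Z) (a i)) /\ y j = \sum_i f i ^+ e' j i * a i.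
  move=> j; have [||a h1 h2] := IH (e' j) (y j); [|exact: yl|by exists a].
  have E' : (\sum_i (e' j i).-1 = (e j).-2 + \sum_(i | i != j) (e i).-1)%N.
    by rewrite (bigD1 j) //= /e' eqxx; congr addn; apply: eq_bigr => i /negPf ->.
  apply/orP; have [ej|ej] := leqP (e j) 1.
    right; apply/existsP; exists j; rewrite /e' eqxx; lia.
  by left; move: hl; rewrite (bigD1 j) //= E'; lia.
exists (fun i => \sum_(j | j != i) f j * a j i + a i i) => [i|].
  apply: degZD.
    apply: big_ind => [||j ji]; [exact: degZ0|by move=> *; apply: degZD|].
    have [/(_ i)/degZM/(_ (f_deg1 j)) + _] := Ha j.
    rewrite mulrC /e' eq_sym (negPf ji).
    by have -> : l.+1%:Z - (e i)%:Z = l%:Z - (e i)%:Z + 1%:Z by lia.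
  have [/(_ i) + _] := Ha i; rewrite /e' eqxx.
  have -> // : l%:Z - ((e i).-1)%:Z = l.+1%:Z - (e i)%:Z by have := epos i; lia.
under eq_bigr do rewrite (Ha _).2 mulr_sumr.
rewrite exchange_big /=; apply: eq_bigr => i _.
rewrite mulrDr mulr_sumr addrC (bigD1 i) //=; congr (_ + _).
  rewrite mulrA /e' eqxx; have := epos i; case: (e i) => // n _.
  by rewrite /= exprS.
by apply: eq_bigr => j ji; rewrite mulrCA /e' eq_sym (negPf ji).
Qed.

Lemma large_degree_in_powers N l (x : R) : (n0 + #|T| * N < l)%N -> sg_deg l x ->
  exists2 a : T -> R, forall j, sg_deg (l - N.+1) (a j) &
    x = \sum_j f j ^+ N.+1 * a j.
Proof.
rewrite -sum_nat_const => hl xl.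
have [|//|a h E] := @degree_in_powers (fun _ => N.+1) l x; first by rewrite hl.
exists a => // j; have := h j; rewrite subzn //.
by move: hl; rewrite (bigD1 j) //=; lia.
Qed.

End PowersOfGenerators.

Lemma ideal_gen_range (T : finType) (f : T -> R) (x : R) :
  ideal_gen (range f) x -> exists a : T -> R, x = \sum_j f j * a j.
Proof.
move: x; apply: ideal_gen_min; first split.
- by exists (fun=> 0); rewrite big1 // => j _; rewrite mulr0.
- move=> _ _ [a ->] [b ->]; exists (fun j => a j + b j).
  by rewrite -big_split; apply: eq_bigr => j _; rewrite mulrDr.
- move=> c _ [a ->]; exists (fun j => c * a j).
  by rewrite mulr_sumr; apply: eq_bigr => j _; rewrite mulrCA.
move=> _ [j _ <-]; exists (fun i => if i == j then 1 else 0).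
rewrite (bigD1 j) //= eqxx mulr1 big1 ?addr0 // => i /negPf ->.
by rewrite mulr0.
Qed.

(** The coefficients of a linear combination of the f j may be replaced with their
    components of degree n, by uniqueness of homogeneous decompositions. *)
Lemma degree1_generators_span m (f : 'I_m -> R) n (x : R) :
  degree1_generators f -> sg_deg n.+1 x ->
  exists2 a : 'I_m -> R, forall j, sg_deg n (a j) & x = \sum_j f j * a j.
Proof.
move=> [f1 fgen] xn.
have : ideal_gen (range f) x by rewrite fgen; apply: ideal_gen_sub; exists n.+1.
move=> /ideal_gen_range[a E].
have /choice[N /choice[c Hc]] := fun j => homogeneous_decomposition (a j).
pose N' := (n.+1 + \sum_j N j)%N.
exists (fun j => c j n) => [j|]; first by have [] := Hc j.
pose e i := if i is i'.+1 then \sum_j f j * c j i' - (if i' == n then x else 0) else 0.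
have e_deg i : sg_deg i (e i).
  case: i => [|i] /=; first exact: sg_deg0.
  apply: sg_degB; last by case: eqP => [->//|_]; apply: sg_deg0.
  by apply: sg_deg_sum => j _; rewrite -add1n; apply: sg_degM => //; case: (Hc j).
suff : e n.+1 = 0 by rewrite /= eqxx => /eqP; rewrite subr_eq0 => /eqP.
apply: (@homogeneous_unique N'.+1) => //; last by rewrite ltnS leq_addr.
rewrite big_ord_recl add0r /= sumrB exchange_big /=.
rewrite -big_mkcond /= (big_pred1 (Ordinal (leq_addr _ _ : (n < N')%N))) //.
apply/eqP; rewrite subr_eq0 E; apply/eqP; apply: eq_bigr => j _.
rewrite -mulr_sumr; congr (_ * _); case: (Hc j) => _ /(_ N') -> //.
by rewrite /N' (bigD1 j) //=; lia.
Qed.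

End GradedPieces.

(** * Localizations of a graded domain inside a field *)

Section DomainLocalizations.
Variables (R : stdGradedRing) (K : fieldType) (phi : {rmorphism R -> K}).
Hypothesis phi_inj : injective phi.
Implicit Types (g h w x : R) (z : K) (n : int).

Lemma phi_neq0 x : (phi x != 0) = (x != 0).
Proof. by rewrite -(inj_eq phi_inj) rmorph0. Qed.

Lemma domain_mulI x : x != 0 -> injective (fun y : R => x * y).
Proof.
by rewrite -phi_neq0 => x0 y y' /(congr1 phi); rewrite !rmorphM => /(mulfI x0)/phi_inj.
Qed.

(** The part of degree n of R[1/g], for g of degree e, as a subset of K. All
    localizations being in one field, restriction maps become inclusions. *)
Definition locK g (e : nat) n z : Prop :=
  exists k r, degZ (n + (k * e)%N%:Z) r /\ z * phi g ^+ k = phi r.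

Lemma locK_large g e n z : sg_deg e g -> locK g e n z ->
  exists N0, forall N, (N0 <= N)%N ->
    exists2 r, degZ (n + (N * e)%N%:Z) r & z * phi g ^+ N = phi r.
Proof.
move=> ge [k [r [rn E]]]; exists k => N kN; exists (r * g ^+ (N - k)).
  have := degZM rn (sg_degX (N - k) ge); congr degZ.
  by rewrite -{2}(subnKC kN) mulnDl PoszD addrA.
by rewrite rmorphM rmorphXn -E -mulrA -exprD subnKC.
Qed.

Lemma locK0 g e n : locK g e n 0.
Proof. by exists 0%N, 0; split; [apply: degZ0|rewrite mul0r rmorph0]. Qed.

Lemma locKN g e n z : locK g e n z -> locK g e n (- z).
Proof.
move=> [k [r [rn E]]]; exists k, (- r); split; first exact: degZN.
by rewrite mulNr E rmorphN.
Qed.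

Lemma locKD g e n z z' : sg_deg e g ->
  locK g e n z -> locK g e n z' -> locK g e n (z + z').
Proof.
move=> ge /(locK_large ge)[N H] /(locK_large ge)[N' H'].
have [r rn E] := H _ (leq_addr N' N); have [r' rn' E'] := H' _ (leq_addl N N').
exists (N + N')%N, (r + r'); split; first exact: degZD.
by rewrite mulrDl E E' rmorphD.
Qed.

Lemma locKB g e n z z' : sg_deg e g ->
  locK g e n z -> locK g e n z' -> locK g e n (z - z').
Proof. by move=> ge zg z'g; apply: locKD => //; apply: locKN. Qed.

Lemma locK_sign g e n p z : locK g e n z -> locK g e n ((-1) ^+ p * z).
Proof.
by move=> zg; rewrite -signr_odd; case: odd; rewrite ?expr1 ?mulN1r ?expr0 ?mul1r //; apply: locKN.
Qed.

Lemma locK_sum g e n (T : Type) (s : seq T) (P : pred T) (F : T -> K) :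
  sg_deg e g -> (forall i, P i -> locK g e n (F i)) ->
  locK g e n (\sum_(i <- s | P i) F i).
Proof.
move=> ge h; apply: big_ind => //; first exact: locK0.
by move=> *; apply: locKD.
Qed.

Lemma locK_mul g e h e' n z : sg_deg e' h -> locK g e n z ->
  locK (g * h) (e + e') n z.
Proof.
move=> he' [k [r [rn E]]]; exists k, (r * h ^+ k); split.
  have := degZM rn (sg_degX k he'); congr degZ.
  by rewrite mulnDr PoszD addrA.
by rewrite !rmorphM rmorphXn exprMn mulrA E.
Qed.

(** Multiplying by a power of h kills the h in the denominator; dividing by w
    is harmless since w already divides the denominator. *)
Lemma locK_clear g eg w ew h eh N L p a n z r :
  sg_deg eg g -> sg_deg ew w -> w != 0 -> sg_deg p a ->
  (p + N * eh = L * ew)%N ->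
  degZ (n + (N * (eg + ew + eh))%N%:Z) r -> z * phi (g * w * h) ^+ N = phi r ->
  locK (g * w) (eg + ew) n (phi (h ^+ N * a) / phi (w ^+ L) * z).
Proof.
move=> gg ww w0 ap pN rn E; exists (N + L)%N, (r * (a * g ^+ L)); split.
  have := degZM rn (sg_degM ap (sg_degX L gg)); congr degZ; nia.
rewrite -phi_neq0 in w0.
rewrite !rmorphM !rmorphXn in E *; rewrite -E !exprMn !exprD.
have wL : phi w ^+ L != 0 by rewrite expf_neq0.
by field.
Qed.

(** The embedding into K of the localization at g, which is meaningful for g
    nonzero. *)
Definition locval g (x : loc g) : K := phi (repr x).1 / phi g ^+ (repr x).2.

Lemma locval_frac g r k : g != 0 -> locval (Defs.frac g r k) = phi r / phi g ^+ k.
Proof.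
rewrite -phi_neq0 => g0; have [l /(congr1 phi)] := repr_frac g r k.
rewrite rmorphM rmorph0 => /eqP; rewrite mulf_eq0 rmorphXn expf_eq0 (negPf g0) andbF /=.
rewrite rmorphB !rmorphM !rmorphXn subr_eq0 /locval => /eqP E.
by apply/eqP; rewrite eqr_div ?expf_neq0 // E.
Qed.

Lemma locvalD g : g != 0 -> {morph @locval g : x y / x + y}.
Proof.
move=> g0 x y; have [r [k ->]] := fracP x; have [s [l ->]] := fracP y.
rewrite fracD !locval_frac // rmorphD !rmorphM !rmorphXn exprD.
rewrite -phi_neq0 in g0; have g0k p : phi g ^+ p != 0 by rewrite expf_neq0.
by field; rewrite !g0k.
Qed.

Lemma locval0 g : g != 0 -> locval (0 : loc g) = 0.
Proof. by move=> g0; rewrite frac0 locval_frac // rmorph0 mul0r. Qed.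

Lemma locvalN g : g != 0 -> {morph @locval g : x / - x}.
Proof.
move=> g0 x; apply/eqP; rewrite -addr_eq0 -locvalD // addNr.
by rewrite locval0.
Qed.

Lemma locval_sign g p (x : loc g) : g != 0 ->
  locval (x *~ (-1) ^+ p) = (-1) ^+ p * locval x.
Proof.
move=> g0; rewrite -signr_odd -[in RHS]signr_odd; case: odd; rewrite ?expr1 ?expr0.
  by rewrite mulrN1z locvalN // mulN1r.
by rewrite mulr1z mul1r.
Qed.

Lemma locval_inj g : g != 0 -> injective (@locval g).
Proof.
move=> g0 x y; have [r [k ->]] := fracP x; have [s [l ->]] := fracP y.
rewrite !locval_frac // => E; apply/eq_frac; exists 0%N.
rewrite expr0 mul1r; apply: phi_inj; rewrite rmorph0 rmorphB !rmorphM !rmorphXn.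
apply/eqP; rewrite subr_eq0; apply/eqP.
rewrite -phi_neq0 in g0; have g0k p : phi g ^+ p != 0 by rewrite expf_neq0.
by apply/eqP; move: E => /eqP; rewrite eqr_div ?g0k.
Qed.

Lemma loc_of_zero (x y : loc (0 : R)) : x = y.
Proof.
have [r [k ->]] := fracP x; have [s [l ->]] := fracP y.
by apply/eq_frac; exists 1%N; rewrite expr1 mul0r.
Qed.

Lemma locval_deg g e n (x : loc g) : g != 0 -> loc_deg e n x -> locK g e n (locval x).
Proof.
move=> g0 [r [k [rn ->]]]; exists k, r; split=> //.
by rewrite locval_frac // divfK // expf_neq0 ?phi_neq0.
Qed.

Lemma locK_locval g e n z : g != 0 -> locK g e n z ->
  exists2 x : loc g, loc_deg e n x & locval x = z.
Proof.
move=> g0 [k [r [rn E]]]; exists (Defs.frac g r k); first by exists r, k.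
by rewrite locval_frac // -E mulfK // expf_neq0 ?phi_neq0.
Qed.

Section CechInField.
Variables (m : nat) (f : 'I_m -> R).
Hypothesis f_gen : degree1_generators f.
Implicit Types (S T : {set 'I_m}) (i : nat) (c b : {set 'I_m} -> K).

Let f1 : forall j, sg_deg 1 (f j) := f_gen.1.

(** The family f may have zero members; the localizations at sets S outside [nzs]
    are zero. *)
Definition nzs : {set 'I_m} := [set j | f j != 0].

Lemma prodf_nzs S : (prodf f S != 0) = (S \subset nzs).
Proof.
rewrite -phi_neq0 /prodf rmorph_prod; apply/prodf_neq0/fintype.subsetP => H j jS.
  by rewrite inE -phi_neq0; apply: H.
by have := H j jS; rewrite inE phi_neq0.
Qed.

(** An additional denominator w allows to localize the whole Cech complex. *)
Definition locS w ew n S z := locK (prodf f S * w) (#|S| + ew) n z.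

Definition cochainK w ew n i c :=
  forall S, S \subset nzs -> #|S| = i -> locS w ew n S (c S).

Definition cocycleK i c :=
  forall T, T \subset nzs -> #|T| = i.+1 -> altd c T = 0.

Lemma prodf1 S j : j \notin S -> prodf f (j |: S) = f j * prodf f S.
Proof. by move=> jS; rewrite /prodf big_setU1. Qed.

Lemma locS_deg w ew S : sg_deg ew w -> sg_deg (#|S| + ew) (prodf f S * w).
Proof. by move=> wew; apply: sg_degM => //; apply: sg_deg_prod. Qed.

Lemma locS_sub w ew n S j z : sg_deg ew w -> j \in S ->
  locS w ew n (S :\ j) z -> locS w ew n S z.
Proof.
move=> wew jS /(locK_mul (f1 j)); rewrite /locS.
have -> : prodf f (S :\ j) * w * f j = prodf f S * w.
  by rewrite -[in RHS](finset.setD1K jS) prodf1 ?setD11 //; ring.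
by rewrite [in X in _ -> X](cardsD1 j) jS [(_ + 1)%N]addnC addnA.
Qed.

Lemma cochainK_altd w ew n i c : sg_deg ew w ->
  (forall S, S \subset nzs -> #|S|.+1 = i -> locS w ew n S (c S)) ->
  cochainK w ew n i (altd c).
Proof.
move=> wew ci S SZ Si; apply: locK_sum => [|j jS]; first exact: locS_deg.
apply: locK_sign; apply: (@locS_sub w ew n S j) => //; apply: ci.
  by apply: fintype.subset_trans (subD1set S j) SZ.
by rewrite -Si [RHS](cardsD1 j) jS.
Qed.

Lemma uniform_bound (T : finType) (P : pred T) (Q : T -> nat -> Prop) :
  (forall x : T, P x -> exists N0, forall N, (N0 <= N)%N -> Q x N) ->
  exists N0, forall N, (N0 <= N)%N -> forall x : T, P x -> Q x N.
Proof.
move=> H; have /choice[N0 HN0] : forall x : T, exists N0, P x -> forall N, (N0 <= N)%N -> Q x N.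
  move=> x; have [/H[N0 h]|] := boolP (P x); first by exists N0.
  by exists 0%N.
exists (\max_(x : T) N0 x) => N le x Px; apply: HN0 => //.
by apply: leq_trans le; apply: leq_bigmax.
Qed.

(** After inverting w, high powers of the f j still generate the unit ideal. The
    coefficients of a relation between them, divided by a power of w, are the
    weights of a homotopy which has no new denominators. *)
Lemma cech_exact w ew n i c : sg_deg ew w -> (0 < ew)%N -> w != 0 ->
  cochainK w ew n i c -> cocycleK i c ->
  exists2 b, forall S, S \subset nzs -> #|S|.+1 = i -> locS w ew n S (b S) &
    forall S, S \subset nzs -> #|S| = i -> altd b S = c S.
Proof.
move=> wew ew0 w0 cn cc.
have [N0 HN0] := @uniform_bound _ (fun S => (S \subset nzs) && (#|S| == i))
  (fun S N => exists2 r, degZ (n + (N * (#|S| + ew))%N%:Z) r &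
     c S * phi (prodf f S * w) ^+ N = phi r)
  (fun S SP => let: conj SZ Si := andP SP in locK_large (locS_deg S wew) (cn S SZ (eqP Si))).
pose N := N0.+1; have {}HN0 S (SZ : S \subset nzs) (Si : #|S| = i) :=
  HN0 N (leqnSn _) S (introT andP (conj SZ (introT eqP Si))).
(* Large enough for w ^+ L to be a combination of the f j ^+ N. *)
pose L := (m * N).+1.
have mNL : (0 + #|'I_m| * N0 < L * ew)%N by rewrite card_ord; nia.
have f_span k (x : R) : (0 <= k)%N -> sg_deg k.+1 x ->
    exists2 a : 'I_m -> R, forall j, sg_deg k (a j) & x = \sum_j f j * a j.
  by move=> _; apply: degree1_generators_span.
have [a an aE] := large_degree_in_powers f1 f_span mNL (sg_degX L wew).
pose W j := phi (f j ^+ N * a j) / phi (w ^+ L).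
have wL : phi (w ^+ L) != 0 by rewrite rmorphXn expf_neq0 ?phi_neq0.
have W0 j : j \notin nzs -> W j = 0.
  by rewrite inE negbK /W => /eqP ->; rewrite expr0n mul0r rmorph0 mul0r.
exists (althom W c) => S SZ Si.
  apply: locK_sum => [|j]; first exact: locS_deg.
  rewrite inE => jS; apply: locK_sign.
  have [jZ|jZ] := boolP (j \in nzs); last by rewrite W0 // mul0r; apply: locK0.
  have jSZ : j |: S \subset nzs by rewrite finset.subUset finset.sub1set jZ.
  have jSi : #|j |: S| = i by rewrite cardsU1 jS.
  have [r rn E] := HN0 _ jSZ jSi.
  apply: (@locK_clear _ _ _ _ (f j) 1%N _ _ (L * ew - N) _ _ _ r) => //.
  - exact: sg_deg_prod.
  - have : (0 < m)%N by case: (j) => j'; apply: leq_ltn_trans.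
    move=> m0; rewrite muln1 subnK // /L /N; nia.
  - by move: rn; congr degZ; rewrite cardsU1 jS; lia.
  - by rewrite -E prodf1 //; congr (_ * phi _ ^+ _); ring.
apply: althomK.
  by rewrite -mulr_suml -rmorph_sum /= -aE divff.
move=> j jS; have [jZ|jZ] := boolP (j \in nzs); last by rewrite W0 // mul0r.
rewrite cc ?mulr0 //; first by rewrite finset.subUset finset.sub1set jZ.
by rewrite cardsU1 jS Si.
Qed.

End CechInField.
End DomainLocalizations.

(** * Regularity from a pair of parameters *)

Section TwoParameters.
Variables (R : stdGradedRing) (K : fieldType) (phi : {rmorphism R -> K}).
Hypothesis phi_inj : injective phi.
Variables (u v : R) (r : nat).
Hypotheses (u1 : sg_deg 1 u) (v1 : sg_deg 1 v) (u0 : u != 0) (v0 : v != 0).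
(** Elements of degree 0 are excluded: in a Rees algebra they give other solutions
    of p v = q u, and local cohomology in negative degrees. *)
Hypothesis uv_regular : forall n (p q : R), sg_deg n.+1 p -> sg_deg n.+1 q ->
  p * v = q * u -> exists2 w, sg_deg n w & p = u * w.
Hypothesis uv_reduction : forall n (x : R), (r <= n)%N -> sg_deg n.+1 x ->
  exists p q, [/\ sg_deg n p, sg_deg n q & x = u * p + v * q].
Hypothesis r_gt0 : (0 < r)%N.
Hypothesis uv_not_reduction : exists2 x : R, sg_deg r x &
  forall p q, sg_deg r.-1 p -> sg_deg r.-1 q -> x <> u * p + v * q.
Hypothesis fin_gen : exists m (f : 'I_m -> R), degree1_generators f.
Implicit Types (p q x w : R) (z e : K).

Lemma uv_regular1 s n p q : sg_deg n.+1 p -> sg_deg (n + s) q ->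
  p * v ^+ s = q * u -> exists2 w, sg_deg n w & p = u * w.
Proof.
elim: s n p q => [|s IH] n p q pn qn E.
  by exists q; [rewrite addn0 in qn|rewrite mulrC -E expr0 mulr1].
have [|||w wn E'] := @uv_regular (n + s) (p * v ^+ s) q.
- by have := sg_degM pn (sg_degX s v1); rewrite muln1 addSn.
- by rewrite -addnS.
- by rewrite -mulrA -exprSr.
by apply: (IH n p w); rewrite // E' mulrC.
Qed.

(** Regularity passes to powers of u and v, the degrees being chosen so that it
    is never applied to elements of degree 0. *)
Lemma uv_regular_powers s t n p q : sg_deg (n + t) p -> sg_deg (n + s) q ->
  p * v ^+ s = q * u ^+ t -> exists2 w, sg_deg n w & p = u ^+ t * w.
Proof.
elim: t n p => [|t IH] n p pn qn E.
  by exists p; rewrite ?expr0 ?mul1r //; rewrite addn0 in pn.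
have [|||w wn E'] := @uv_regular1 s (n + t) p (q * u ^+ t).
- by rewrite -addnS.
- by have := sg_degM qn (sg_degX t u1); rewrite muln1 addnAC.
- by rewrite E -mulrA -exprSr.
have [//|//||w' wn' E''] := IH n w.
  apply: (domain_mulI phi_inj u0) => /=.
  by rewrite mulrA -E' E exprSr mulrA mulrC.
by exists w' => //; rewrite E' E'' mulrA -exprS.
Qed.

Lemma uv_powers N l x : (r + 2 * N < l)%N -> sg_deg l x ->
  exists p q, [/\ sg_deg (l - N.+1) p, sg_deg (l - N.+1) q & x = u ^+ N.+1 * p + v ^+ N.+1 * q].
Proof.
move=> hl xl; pose f (i : bool) := if i then u else v.
have f1 i : sg_deg 1 (f i) by case: i.
have fg n y : (r <= n)%N -> sg_deg n.+1 y ->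
    exists2 a : bool -> R, forall j, sg_deg n (a j) & y = \sum_j f j * a j.
  move=> rn yn; have [p [q [pn qn ->]]] := uv_reduction rn yn.
  exists (fun i : bool => if i then p else q); first by case.
  by rewrite big_bool.
have [|a an ->] := large_degree_in_powers (N := N) f1 fg _ xl; first by rewrite card_bool.
by exists (a true), (a false); rewrite big_bool.
Qed.

Lemma uv_unity w ew N : sg_deg ew w -> (0 < ew)%N -> w != 0 ->
  exists L p q, [/\ (N.+1 <= L * ew)%N, sg_deg (L * ew - N.+1) p,
    sg_deg (L * ew - N.+1) q &
    phi (u ^+ N.+1 * p) / phi (w ^+ L) + phi (v ^+ N.+1 * q) / phi (w ^+ L) = 1].
Proof.
move=> wew ew0 w0; pose L := (r + 2 * N).+1.
have hL : (r + 2 * N < L * ew)%N by rewrite /L; nia.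
have [p [q [pn qn E]]] := uv_powers hL (sg_degX L wew).
exists L, p, q; split=> //; first by lia.
by rewrite -mulrDl -rmorphD -E divff // rmorphXn expf_neq0 ?phi_neq0.
Qed.

(** A power of w lies in the ideal of u^N and v^N ([uv_unity]), so u and v cover
    the locus where w is invertible. This is the sheaf property for that cover. *)
Lemma loc_uv_inter w ew (n : int) z : sg_deg ew w -> (0 < ew)%N -> w != 0 ->
  locK phi (w * u) (ew + 1) n z -> locK phi (w * v) (ew + 1) n z ->
  locK phi w ew n z.
Proof.
move=> wew ew0 w0 /(locK_large (sg_degM wew u1))[N1 H1].
move=> /(locK_large (sg_degM wew v1))[N2 H2].
pose N := (N1 + N2)%N.
have [|r1 r1n E1] := H1 N.+1; first by rewrite /N; lia.
have [|r2 r2n E2] := H2 N.+1; first by rewrite /N; lia.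
have [L [p [q [NL pn qn uv1]]]] := uv_unity N wew ew0 w0.
rewrite -[z]mul1r -{}uv1 mulrDl.
apply: locKD => //; rewrite -[w in locK _ w]mul1r -[ew in locK _ _ ew]add0n.
  by apply: (locK_clear phi_inj (sg_deg1 R) wew w0 pn _ r1n);
    rewrite ?mul1r //; lia.
by apply: (locK_clear phi_inj (sg_deg1 R) wew w0 qn _ r2n);
    rewrite ?mul1r //; lia.
Qed.

(** The vanishing of the first cohomology of the same cover. *)
Lemma loc_uv_sum w ew (n : int) z : sg_deg ew w -> (0 < ew)%N -> w != 0 ->
  locK phi (w * (u * v)) (ew + 2) n z ->
  exists z1 z2, [/\ locK phi (w * u) (ew + 1) n z1, locK phi (w * v) (ew + 1) n z2 &
    z = z1 - z2].
Proof.
move=> wew ew0 w0 /(locK_large (sg_degM wew (sg_degM u1 v1)))[N H].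
have {H} [s sn E] := H _ (leqnSn N).
have [L [p [q [NL pn qn uv1]]]] := uv_unity N wew ew0 w0.
exists (phi (v ^+ N.+1 * q) / phi (w ^+ L) * z), (- (phi (u ^+ N.+1 * p) / phi (w ^+ L) * z)).
split; last by rewrite opprK addrC -mulrDl uv1 mul1r.
  rewrite [w * u]mulrC [(ew + 1)%N]addnC.
  apply: (locK_clear (eh := 1%N) (h := v) phi_inj u1 wew w0 qn); first by lia.
    by move: sn; congr degZ; lia.
  by rewrite -E; congr (_ * phi _ ^+ _); ring.
apply: locKN; rewrite [w * v]mulrC [(ew + 1)%N]addnC.
apply: (locK_clear (eh := 1%N) (h := u) phi_inj v1 wew w0 pn); first by lia.
  by move: sn; congr degZ; lia.
by rewrite -E; congr (_ * phi _ ^+ _); ring.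
Qed.

(** For w = 1 the sheaf property is a consequence of regularity, and is limited to
    nonnegative degrees. *)
Lemma uv_inter (n : int) z : 0 <= n -> locK phi u 1 n z -> locK phi v 1 n z -> locK phi 1 0 n z.
Proof.
case: n => // n _ /(locK_large u1)[N1 H1] /(locK_large v1)[N2 H2].
have [r1 r1n E1] := H1 _ (leq_addr N2 N1); have [r2 r2n E2] := H2 _ (leq_addl N1 N2).
set N := (N1 + N2)%N in r1n E1 r2n E2; rewrite !muln1 in r1n r2n.
have [|w wn E] := uv_regular_powers (s := N) (t := N) r1n r2n.
  apply: phi_inj; rewrite !rmorphM !rmorphXn -E1 -E2; ring.
exists 0%N, w; split; first by rewrite mul0n addr0.
rewrite expr0 mulr1; apply: (mulIf (_ : phi u ^+ N != 0)).
  by rewrite expf_neq0 ?phi_neq0.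
by rewrite E1 E rmorphM rmorphXn mulrC.
Qed.

(** A numerator of degree n + 2N >= r + 2N - 1 is a combination of u^N and v^N. *)
Lemma uv_sum (n : int) z : r%:Z <= n + 1 -> 0 <= n -> locK phi (u * v) 2 n z ->
  exists z1 z2, [/\ locK phi u 1 n z1, locK phi v 1 n z2 & z = z1 - z2].
Proof.
case: n => // n rn _ /(locK_large (sg_degM u1 v1))[N H].
have {H} [s sn E] := H _ (leqnSn N).
have [||p [q [pn qn sE]]] := @uv_powers N (n + N.+1 * 2)%N s.
- by lia.
- by move: sn; congr degZ; lia.
have [u0' v0'] : phi u != 0 /\ phi v != 0 by rewrite !phi_neq0.
move: E; rewrite rmorphM {}sE exprMn => E.
have uN k : phi u ^+ k != 0 by rewrite expf_neq0.
have vN k : phi v ^+ k != 0 by rewrite expf_neq0.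
exists (phi q / phi u ^+ N.+1), (- (phi p / phi v ^+ N.+1)); split.
- exists N.+1, q; rewrite divfK //; split=> //.
  by have -> : n%:Z + (N.+1 * 1)%N%:Z = Posz (n + N.+1 * 2 - N.+1) by lia.
- apply: locKN; exists N.+1, p; rewrite divfK //; split=> //.
  by have -> : n%:Z + (N.+1 * 1)%N%:Z = Posz (n + N.+1 * 2 - N.+1) by lia.
apply: (mulIf (_ : phi u ^+ N.+1 * phi v ^+ N.+1 != 0)).
  by rewrite mulf_neq0.
rewrite E rmorphD !rmorphM !rmorphXn opprK.
by field; rewrite uN vN.
Qed.

(** By regularity of the powers, a decomposition of x / (u v) would put x in the
    ideal of u and v. *)
Lemma uv_not_sum z1 z2 x : sg_deg r x ->
  (forall p q, sg_deg r.-1 p -> sg_deg r.-1 q -> x <> u * p + v * q) ->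
  locK phi u 1 (r%:Z - 2) z1 -> locK phi v 1 (r%:Z - 2) z2 ->
  phi x / (phi u * phi v) <> z1 - z2.
Proof.
move=> xr xN /(locK_large u1)[N1 H1] /(locK_large v1)[N2 H2] E.
have [k [k0 k1 k2]] : exists k, [/\ (0 < k)%N, (N1 <= k.+1)%N & (N2 <= k.+1)%N].
  by exists (N1 + N2).+1; split; lia.
have [a an aE] := H1 _ k1; have [b bn bE] := H2 _ k2.
have eqd : r%:Z - 2 + (k.+1 * 1)%N%:Z = Posz (r.-1 + k) by lia.
rewrite {}eqd /= in an bn.
have rr : r = r.-1.+1 by rewrite prednK.
have [u0' v0'] : phi u != 0 /\ phi v != 0 by rewrite !phi_neq0.
have {E} E : x * u ^+ k * v ^+ k = a * v ^+ k.+1 - b * u ^+ k.+1.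
  apply: phi_inj; rewrite rmorphB !rmorphM !rmorphXn -aE -bE.
  transitivity (phi x / (phi u * phi v) * phi u ^+ k.+1 * phi v ^+ k.+1).
    by rewrite !exprS; field; rewrite u0' v0'.
  by rewrite E; ring.
have [|||w wn E1] := @uv_regular_powers k k.+1 r.-1 (x * u ^+ k - a * v) (- b).
- apply: sg_degB.
    by have := sg_degM xr (sg_degX k u1); rewrite muln1 {1}rr addSnnS.
  by have := sg_degM an v1; rewrite addn1 addnS.
- exact: sg_degN.
- have -> : (x * u ^+ k - a * v) * v ^+ k = x * u ^+ k * v ^+ k - a * v ^+ k.+1.
    by rewrite exprS; ring.
  by rewrite E; ring.
have {}E1 : a * v ^+ 1 = (x - u * w) * u ^+ k.
  have -> : a * v ^+ 1 = x * u ^+ k - (x * u ^+ k - a * v) by ring.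
  by rewrite E1 exprS; ring.
have [|||w' wn' E2] := @uv_regular_powers 1 k r.-1 a (x - u * w) => //.
  by rewrite addn1 -rr; apply: sg_degB => //; have := sg_degM u1 wn; rewrite add1n -rr.
apply: (xN w w') => //; apply/eqP; rewrite addrC -subr_eq; apply/eqP.
apply: (domain_mulI phi_inj (_ : u ^+ k != 0)) => /=.
  by rewrite -(phi_neq0 phi_inj) rmorphXn expf_neq0.
by rewrite mulrC -E1 E2; ring.
Qed.

Section CechComplex.
Variables (m : nat) (f : 'I_m -> R).
Hypothesis f_gen : degree1_generators f.
Implicit Types (S T : {set 'I_m}) (i : nat) (c b : {set 'I_m} -> K) (n : int).

Let uv2 : sg_deg 2 (u * v) := sg_degM u1 v1.

Lemma uv_neq0 : u * v != 0.
Proof. by rewrite -(phi_neq0 phi_inj) rmorphM mulf_neq0 ?phi_neq0. Qed.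

Lemma prodf_set0 : prodf f finset.set0 = 1.
Proof. by rewrite /prodf big_set0. Qed.

Lemma locS_u n S z : locK phi (prodf f S) #|S| n z -> locS phi f u 1 n S z.
Proof. exact: locK_mul. Qed.

Lemma locS_v n S z : locK phi (prodf f S) #|S| n z -> locS phi f v 1 n S z.
Proof. exact: locK_mul. Qed.

Lemma locS_u_uv n S z : locS phi f u 1 n S z -> locS phi f (u * v) 2 n S z.
Proof. by move/(locK_mul v1); rewrite /locS mulrA addn2 !addn1. Qed.

Lemma locS_v_uv n S z : locS phi f v 1 n S z -> locS phi f (u * v) 2 n S z.
Proof. by move/(locK_mul u1); rewrite /locS [u * v]mulrC mulrA addn2 !addn1. Qed.

Lemma locS_inter n S z : S \subset nzs f -> (0 < #|S|)%N || (0 <= n) ->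
  locS phi f u 1 n S z -> locS phi f v 1 n S z -> locK phi (prodf f S) #|S| n z.
Proof.
move=> SZ; have [S0|S0] := posnP #|S|; last first.
  move=> _; apply: loc_uv_inter => //; first by apply: sg_deg_prod; case: f_gen.
  by rewrite (prodf_nzs phi_inj).
have -> : S = finset.set0 by apply/eqP; rewrite -cards_eq0 S0.
by rewrite /locS prodf_set0 cards0 !mul1r !add0n; apply: uv_inter.
Qed.

Lemma locS_sum n S z : S \subset nzs f -> (0 < #|S|)%N || (r%:Z <= n + 1) ->
  locS phi f (u * v) 2 n S z ->
  exists z1 z2, [/\ locS phi f u 1 n S z1, locS phi f v 1 n S z2 & z = z1 - z2].
Proof.
move=> SZ; have [S0|S0] := posnP #|S|; last first.
  move=> _; apply: loc_uv_sum => //; first by apply: sg_deg_prod; case: f_gen.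
  by rewrite (prodf_nzs phi_inj).
have -> : S = finset.set0 by apply/eqP; rewrite -cards_eq0 S0.
rewrite /locS prodf_set0 cards0 !mul1r !add0n /= => rn; apply: uv_sum => //; lia.
Qed.

(** The primitives bu and bv of c over R_u and R_v differ by the coboundary of some
    e over R_uv. Splitting e as eu - ev corrects them into a primitive which is
    both over R_u and over R_v. Only the empty set needs a condition on n: it
    enters the splitting for i = 2 and the intersection for i = 1. *)
Lemma cech_vanish i n c : r%:Z < n + i%:Z ->
  (forall S, S \subset nzs f -> #|S| = i -> locK phi (prodf f S) #|S| n (c S)) ->
  cocycleK f i c ->
  exists2 b, forall S, S \subset nzs f -> #|S|.+1 = i -> locK phi (prodf f S) #|S| n (b S) &
    forall S, S \subset nzs f -> #|S| = i -> altd b S = c S.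
Proof.
move=> rni cn cc.
have [|bu bu1 bu2] := cech_exact phi_inj f_gen u1 isT u0 (n := n) _ cc.
  by move=> S SZ Si; apply: locS_u; apply: cn.
have [|bv bv1 bv2] := cech_exact phi_inj f_gen v1 isT v0 (n := n) _ cc.
  by move=> S SZ Si; apply: locS_v; apply: cn.
case: i => [|i] in rni cn cc bu1 bu2 bv1 bv2 *; first by exists bu.
have [||e e1 e2] := cech_exact phi_inj f_gen uv2 isT uv_neq0
    (n := n) (i := i) (c := fun S => bu S - bv S).
- move=> S SZ Si; apply: locKB.
  + by apply: locS_deg.
  + by apply: locS_u_uv; apply: bu1; rewrite ?Si.
  + by apply: locS_v_uv; apply: bv1; rewrite ?Si.
- by move=> T TZ Ti; rewrite altdB bu2 // bv2 // subrr.
have /choice[eu /choice[ev eP]] : forall S, exists z1 z2,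
    S \subset nzs f -> #|S|.+1 = i ->
    [/\ locS phi f u 1 n S z1, locS phi f v 1 n S z2 & e S = z1 - z2].
  move=> S; have [SZ|] := boolP (S \subset nzs f); last by exists 0, 0.
  have [Si|Si] := eqVneq #|S|.+1 i; last by exists 0, 0 => _ /eqP; rewrite (negPf Si).
  have [||z1 [z2 zP]] := locS_sum SZ (z := e S) (n := n); last by exists z1, z2.
    by have [S0|//] := posnP #|S|; move: rni; rewrite -Si S0 /=; lia.
  exact: e1.
have eE S : S \subset nzs f -> #|S| = i ->
    bu S - altd eu S = bv S - altd ev S.
  move=> SZ Si; apply/eqP; rewrite subr_eq addrAC -addrA -altdB addrC -subr_eq.
  rewrite -(e2 S) //; apply/eqP/eq_altd => j jS; case: (eP (S :\ j)) => //.
    by apply: fintype.subset_trans SZ; apply: subD1set.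
  by rewrite -Si [RHS](cardsD1 j) jS.
exists (fun S => bu S - altd eu S) => S SZ; last first.
  by move=> Si; rewrite altdB altd_altd subr0 bu2.
move=> [Si]; apply: locS_inter => //.
- by have [S0|//] := posnP #|S|; move: rni r_gt0; rewrite -Si S0 /=; lia.
- apply: locKB; [exact: locS_deg|by apply: bu1; rewrite ?Si|].
  apply: (cochainK_altd f_gen u1 (i := i)) => // T TZ Ti.
  by case: (eP T TZ Ti).
rewrite eE //; apply: locKB; [exact: locS_deg|by apply: bv1; rewrite ?Si|].
apply: (cochainK_altd f_gen v1 (i := i)) => // T TZ Ti.
by case: (eP T TZ Ti).
Qed.

(** The class comes from x / (u v) by the chase of [cech_vanish] run backwards, and
    a primitive of it would decompose x / (u v). *)
Lemma cech_nonvanish : exists c,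
  [/\ forall S, S \subset nzs f -> #|S| = 2 -> locK phi (prodf f S) #|S| (r%:Z - 2) (c S),
      cocycleK f 2 c
    & ~ exists2 b, forall S, S \subset nzs f -> #|S| = 1%N ->
                     locK phi (prodf f S) #|S| (r%:Z - 2) (b S) &
          forall S, S \subset nzs f -> #|S| = 2 -> altd b S = c S].
Proof.
have [x xr xN] := uv_not_reduction.
pose e S := phi x / (phi u * phi v); set n := r%:Z - 2.
have eloc S : locS phi f (u * v) 2 n S (e S).
  have : locK phi (u * v) 2 n (e S).
    exists 1%N, x; split; first by rewrite /n mul1n subrK.
    by rewrite expr1 rmorphM divfK // mulf_neq0 ?phi_neq0.
  move/(locK_mul (sg_deg_prod S f_gen.1)).
  by rewrite /locS [_ * prodf f S]mulrC [(_ + #|S|)%N]addnC.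
have /choice[eu /choice[ev eP]] : forall S, exists z1 z2,
    S \subset nzs f -> #|S| = 1%N ->
    [/\ locS phi f u 1 n S z1, locS phi f v 1 n S z2 & e S = z1 - z2].
  move=> S; have [SZ|] := boolP (S \subset nzs f); last by exists 0, 0.
  have [Si|Si] := eqVneq #|S| 1%N; last by exists 0, 0 => _ /eqP; rewrite (negPf Si).
  have [||z1 [z2 zP]] := locS_sum SZ (z := e S) (n := n); last by exists z1, z2.
    by rewrite Si.
  exact: eloc.
have card1 S j : j \in S -> #|S| = 2 -> #|S :\ j| = 1%N.
  by move=> jS; rewrite (cardsD1 j) jS => -[].
have sub1 S j : S \subset nzs f -> S :\ j \subset nzs f.
  by apply: fintype.subset_trans; apply: subD1set.
have euv S : S \subset nzs f -> #|S| = 2 -> altd eu S = altd ev S.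
  move=> SZ S2; apply/eqP; rewrite -subr_eq0 -altdB; apply/eqP.
  rewrite -(altd_altd e S); apply: eq_altd => j jS.
  have [|_ _ <-] := eP _ (sub1 _ j SZ); first exact: card1.
  have /cards1P[l ->] : #|S :\ j| == 1%N by rewrite card1.
  by rewrite altd1.
exists (altd eu); split=> [S SZ S2|T _ _|]; last 1 first.
- move=> [b b1 b2].
  have glue w (w1 : sg_deg 1 w) (w0 : w != 0) ew :
      (forall S, S \subset nzs f -> #|S| = 1%N -> locS phi f w 1 n S (ew S)) ->
      (forall S, S \subset nzs f -> #|S| = 1%N -> locS phi f w 1 n S (b S)) ->
      (forall S, S \subset nzs f -> #|S| = 2 -> altd ew S = altd eu S) ->
      exists2 z, locK phi w 1 n z & forall j, j \in nzs f -> ew [set j] = b [set j] + z.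
    move=> ewP bP ewE.
    have [||p p1 p2] := cech_exact phi_inj f_gen w1 isT w0
        (n := n) (i := 1%N) (c := fun S => ew S - b S).
    + by move=> S SZ S1; apply: locKB; [exact: locS_deg|exact: ewP|exact: bP].
    + by move=> T TZ T2; rewrite altdB ewE // b2 // subrr.
    exists (p finset.set0) => [|j jZ].
      have := p1 _ (finset.sub0set _); rewrite cards0 => /(_ erefl).
      by rewrite /locS prodf_set0 cards0 mul1r add0n.
    have := p2 [set j]; rewrite altd1 cards1 => -> //; first by rewrite addrC subrK.
    by rewrite finset.sub1set.
  have [||//|zu zuP zuE] := glue u u1 u0 eu.
  + by move=> S SZ S1; case: (eP S SZ S1).
  + by move=> S SZ S1; apply: locS_u; apply: b1.
  have [|||zv zvP zvE] := glue v v1 v0 ev.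
  + by move=> S SZ S1; case: (eP S SZ S1).
  + by move=> S SZ S1; apply: locS_v; apply: b1.
  + by move=> S SZ S2; rewrite euv.
  apply: (uv_not_sum xr xN zuP zvP).
  have [j jZ|Z0] := pickP (mem (nzs f)); last first.
    have [a _ uE] := degree1_generators_span f_gen u1.
    case/eqP: u0; rewrite uE big1 // => j _; have := Z0 j.
    by rewrite !inE => /negbFE/eqP ->; rewrite mul0r.
  have [||_ _ E] := eP [set j]; rewrite ?cards1 ?finset.sub1set //.
  by rewrite -[LHS]/(e [set j]) E zuE // zvE //; ring.
- apply: locS_inter => //; first by rewrite S2.
    apply: (cochainK_altd f_gen u1 (i := 2)) => // T TZ [Ti].
    by case: (eP T TZ Ti).
  rewrite euv //; apply: (cochainK_altd f_gen v1 (i := 2)) => // T TZ [Ti].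
  by case: (eP T TZ Ti).
exact: altd_altd.
Qed.

Lemma locval_cech_d (c : cochain f) T : T \subset nzs f ->
  locval phi (cech_d c T) = altd (fun S => locval phi (c S)) T.
Proof.
move=> TZ; have T0 : prodf f T != 0 by rewrite (prodf_nzs phi_inj).
rewrite /cech_d (big_morph _ (locvalD phi_inj T0) (locval0 phi_inj T0)).
apply: eq_bigr => j jT; rewrite locval_sign //; congr (_ * _).
have Tj : prodf f T = prodf f (T :\ j) * f j.
  by rewrite -{1}(finset.setD1K jT) prodf1 ?setD11 // mulrC.
have [s [k ->]] := fracP (c (T :\ j)); rewrite (loc_res_frac _ _ Tj).
have Tj0 : prodf f (T :\ j) != 0.
  by rewrite (prodf_nzs phi_inj); apply: fintype.subset_trans TZ; apply: subD1set.
rewrite !locval_frac // Tj !rmorphM !rmorphXn exprMn.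
have fj0 : phi (f j) ^+ k != 0.
  by rewrite expf_neq0 ?phi_neq0 //; have := fintype.subsetP TZ _ jT; rewrite inE.
by rewrite -mulf_div divff // mulr1.
Qed.

Lemma loc_zero_prodf S (x y : loc (prodf f S)) : ~~ (S \subset nzs f) -> x = y.
Proof.
rewrite -(prodf_nzs phi_inj) negbK => /eqP; move: x y.
by move: (prodf f S) => g x y g0; subst g; apply: loc_of_zero.
Qed.

Lemma lift_cochain n (P : pred {set 'I_m}) c :
  (forall S, S \subset nzs f -> P S -> locK phi (prodf f S) #|S| n (c S)) ->
  exists2 c' : cochain f, forall S, P S -> loc_deg #|S| n (c' S) &
    forall S, S \subset nzs f -> P S -> locval phi (c' S) = c S.
Proof.
move=> cP.
have H S : {x : loc (prodf f S) | P S -> loc_deg #|S| n x /\ (S \subset nzs f -> locval phi x = c S)}.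
  apply: cid; have [PS|] := boolP (P S); last by exists 0.
  have [SZ|SZ] := boolP (S \subset nzs f); last first.
    exists 0; split=> //; exists 0, 0%N; split; [exact: degZ0|exact: frac0].
  have [|x xn xE] := locK_locval phi_inj _ (cP S SZ PS); last by exists x.
  by rewrite (prodf_nzs phi_inj).
by exists (fun S => sval (H S)) => S; case: (H S) => x /= h; [move=> /h[]|move=> SZ /h[_ ->]].
Qed.

Lemma cech_cohomology_bound i n : cech_cohomology_neq0 f i n -> n + i%:Z <= r%:Z.
Proof.
move=> [c [cn cc cb]]; rewrite leNgt; apply/negP => rni; apply: cb.
have [||b bn bE] := @cech_vanish i n (fun S => locval phi (c S)) rni.
- by move=> S SZ Si; apply: locval_deg; rewrite ?(prodf_nzs phi_inj) //; apply: cn.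
- by move=> T TZ Ti; rewrite -locval_cech_d // cc // locval0 // (prodf_nzs phi_inj).
have [|b' bn' bE'] := @lift_cochain n (fun S => #|S|.+1 == i) b.
  by move=> S SZ /eqP Si; apply: bn.
exists b'; split; first by move=> j ji S Sj; apply: bn'; rewrite Sj ji.
move=> S Si; have [SZ|SZ] := boolP (S \subset nzs f); last exact: loc_zero_prodf.
apply: (locval_inj phi_inj); first by rewrite (prodf_nzs phi_inj).
rewrite locval_cech_d // -bE //; apply: eq_altd => j jS; rewrite bE' //.
  by apply: fintype.subset_trans SZ; apply: subD1set.
by rewrite -Si [X in _ == X](cardsD1 j) jS.
Qed.

Lemma cech_cohomology2 : cech_cohomology_neq0 f 2 (r%:Z - 2).
Proof.
have [c [cn cc cb]] := cech_nonvanish.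
have [|c' cn' cE'] := @lift_cochain (r%:Z - 2) (fun S => #|S| == 2) c.
  by move=> S SZ /eqP Si; apply: cn.
exists c'; split=> [S Si|T T3|[b [bn bE]]]; first by apply: cn'; rewrite Si.
  have [TZ|TZ] := boolP (T \subset nzs f); last exact: loc_zero_prodf.
  have T0 : prodf f T != 0 by rewrite (prodf_nzs phi_inj).
  apply: (locval_inj phi_inj) => //; rewrite locval_cech_d // locval0 //.
  rewrite -(cc T TZ T3); apply: eq_altd => j jT; rewrite cE' //.
    by apply: fintype.subset_trans TZ; apply: subD1set.
  by rewrite -eqSS -T3 [X in _ == X](cardsD1 j) jT.
apply: cb; exists (fun S => locval phi (b S)) => S SZ Si.
  by apply: locval_deg; rewrite ?(prodf_nzs phi_inj) //; apply: bn.
by rewrite -locval_cech_d // -bE // cE' // Si.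
Qed.

End CechComplex.

Lemma int_bounded_max (P : int -> Prop) n0 B : P n0 -> (forall n, P n -> n <= B) ->
  exists2 n, P n & forall n', P n' -> n' <= n.
Proof.
move=> Pn0 PB; pose Q k := `[< P (n0 + k%:Z) >].
have exQ : exists k, Q k by exists 0%N; apply/asboolP; rewrite addr0.
have Qb k : Q k -> (k <= `|B - n0|)%N by move/asboolP/PB; lia.
case: (ex_maxnP exQ Qb) => k /asboolP Pk kmax; exists (n0 + k%:Z) => // n Pn.
have [le|/ltW le] := leP n n0; first by lia.
have := kmax `|n - n0|%N; rewrite /Q.
have -> : n0 + `|n - n0|%N%:Z = n by lia.
by move=> /(_ (introT (asboolP _) Pn)); lia.
Qed.

(** The Cech complexes satisfy H^i_n = 0 for n > r - i ([cech_cohomology_bound]), and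
    the bound is attained by H^2 ([cech_cohomology2]). *)
Theorem regularity_of_parameters : regularity R r%:Z.
Proof.
have bnd i n : local_cohomology_neq0 R i n -> n + i%:Z <= r%:Z.
  by move=> [m [f [fg]]]; apply: cech_cohomology_bound.
have top : local_cohomology_neq0 R 2 (r%:Z - 2).
  by have [m [f fg]] := fin_gen; exists m, f; split=> //; apply: cech_cohomology2.
have /choice[a aP] : forall i, exists a, a_invariant R i a.
  move=> i; have [[n nP]|none] := pselect (exists n, local_cohomology_neq0 R i n).
    have [n' n'P n'max] := @int_bounded_max (local_cohomology_neq0 R i) n (r%:Z - i%:Z) nP
      (fun n' H => let: le := bnd _ _ H in ltac:(lia)).
    by exists (Some n').
  by exists None => n nP; apply: none; exists n.
exists a; split=> // [|i n ai].
  exists 2; case a2 : (a 2) (aP 2) => [n|] /=; last by move/(_ _ top).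
  by case=> nP nmax; exists n; split=> //; have := bnd _ _ nP; have := nmax _ top; lia.
by have := aP i; rewrite ai => -[/bnd].
Qed.

End TwoParameters.

(** * Polynomials in two variables and their dehomogenizations *)

Section TwoVariables.
Variable k : fieldType.
Local Notation A := {mpoly k[2]}.
Implicit Types (p q : A) (g : {poly k}) (m : 'X_{1..2}).

Definition mxy (al be : nat) : 'X_{1..2} := (U_(ord0) *+ al + U_(ord_max) *+ be)%MM.

Lemma mxy0 al be : mxy al be ord0 = al.
Proof. by rewrite mnmDE !mulmnE !mnm1E /= mul1n mul0n addn0. Qed.

Lemma mxy1 al be : mxy al be ord_max = be.
Proof. by rewrite mnmDE !mulmnE !mnm1E /= mul1n mul0n. Qed.

Lemma mnm2P m m' : m ord0 = m' ord0 -> m ord_max = m' ord_max -> m = m'.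
Proof.
move=> e0 e1; apply/mnmP => i; case: (unliftP ord0 i) => [j ->|-> //].
by have -> : lift ord0 j = ord_max by apply: val_inj; rewrite /= ord1.
Qed.

Lemma mxyE m : m = mxy (m ord0) (m ord_max).
Proof. by apply: mnm2P; rewrite (mxy0, mxy1). Qed.

Lemma mxyD al be al' be' : (mxy al be + mxy al' be')%MM = mxy (al + al') (be + be').
Proof. by apply: mnm2P; rewrite mnmDE !(mxy0, mxy1). Qed.

Lemma mnmD_mxy0 m al be : (m + mxy al be)%MM ord0 = (m ord0 + al)%N.
Proof. by rewrite mnmDE mxy0. Qed.

Lemma mnmD_mxy1 m al be : (m + mxy al be)%MM ord_max = (m ord_max + be)%N.
Proof. by rewrite mnmDE mxy1. Qed.

Lemma mpolyXxy al be : 'X_[mxy al be] = 'X_ord0 ^+ al * 'X_ord_max ^+ be :> A.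
Proof. by rewrite mpolyXD -!mpolyXn. Qed.

Definition supp_in (P : nat -> nat -> Prop) : set A :=
  [set p | forall m, p@_m != 0 -> P (m ord0) (m ord_max)].

Lemma mcoeffM_neq0 p q m : (p * q)@_m != 0 ->
  exists m1 m2, [/\ p@_m1 != 0, q@_m2 != 0 & m = (m1 + m2)%MM].
Proof.
rewrite -mcoeff_msupp => /msuppM_le /allpairsP[[m1 m2] /= [h1 h2 ->]].
by exists m1, m2; rewrite -!mcoeff_msupp.
Qed.

Lemma supp_in_ideal P : (forall al be al' be', P al be -> P (al + al')%N (be + be')%N) ->
  is_ideal (supp_in P).
Proof.
move=> Pup; split.
- by move=> m; rewrite mcoeff0 eqxx.
- move=> p q Pp Pq m; rewrite mcoeffD.
  have [->|/Pp //] := eqVneq p@_m 0; rewrite add0r; exact: Pq.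
- move=> p q Pq m /mcoeffM_neq0[m1 [m2 [_ /Pq h ->]]].
  by rewrite !mnmDE ![(m1 _ + _)%N]addnC; apply: Pup.
Qed.

Lemma supp_inM (P Q S : nat -> nat -> Prop) p q :
  (forall al be al' be', P al be -> Q al' be' -> S (al + al')%N (be + be')%N) ->
  supp_in P p -> supp_in Q q -> supp_in S (p * q).
Proof.
by move=> PQS Pp Qq m /mcoeffM_neq0[m1 [m2 [/Pp h1 /Qq h2 ->]]]; rewrite !mnmDE; apply: PQS.
Qed.

Lemma supp_in_X (P : nat -> nat -> Prop) al be : P al be -> supp_in P 'X_[mxy al be].
Proof. by move=> h m; rewrite mcoeffX; case: (mxy al be =P m) => [<- _|_]; rewrite ?eqxx // mxy0 mxy1. Qed.

(** An ideal contains a polynomial as soon as it contains its monomials. *)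
Lemma ideal_supp (K : set A) P p : is_ideal K ->
  (forall al be, P al be -> K 'X_[mxy al be]) -> supp_in P p -> K p.
Proof.
move=> iK KP Pp; rewrite [p]mpolyE big_seq_cond; apply: ideal_sum => // m.
rewrite andbT => mp; have [_ _ mK] := iK.
rewrite -mul_mpolyC; apply: mK; rewrite [m]mxyE; apply/KP/Pp.
by rewrite -mcoeff_msupp.
Qed.

Lemma ideal_gen2 (f g : A) (p : A) : ideal_gen [set f; g]%classic p ->
  exists s t, p = f * s + g * t.
Proof.
move: p; apply: ideal_gen_min; first split.
- by exists 0, 0; rewrite !mulr0 addr0.
- by move=> _ _ [s [t ->]] [s' [t' ->]]; exists (s + s'), (t + t'); ring.
- by move=> c _ [s [t ->]]; exists (c * s), (c * t); ring.
by move=> _ [->|->]; [exists 1, 0|exists 0, 1]; rewrite !(mulr0, mulr1, addr0, add0r).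
Qed.

Lemma ideal_mul_gen2 (f g : A) (K : set A) p : is_ideal K ->
  ideal_mul (ideal_gen [set f; g]%classic) K p ->
  exists s t, [/\ K s, K t & p = f * s + g * t].
Proof.
move=> [K0 aK mK]; move: p; apply: ideal_gen_min; first split.
- by exists 0, 0; rewrite !mulr0 addr0.
- move=> _ _ [s [t [Ks Kt ->]]] [s' [t' [Ks' Kt' ->]]]; exists (s + s'), (t + t').
  by split; [exact: aK|exact: aK|ring].
- by move=> c _ [s [t [Ks Kt ->]]]; exists (c * s), (c * t); split; [exact: mK|exact: mK|ring].
move=> _ [_ /ideal_gen2[s [t ->]] [q Kq <-]].
by exists (s * q), (t * q); split; [exact: mK|exact: mK|ring].
Qed.

(** x |-> z, y |-> z T: the degree becomes the exponent of z, the coefficient of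
    z^e being the dehomogenization of the form of degree e. *)
Definition dehom_hom : A -> {poly {poly k}} :=
  mmap ((@polyC {poly k}) \o (@polyC k))
    (fun i : 'I_2 => if i == ord0 then 'X else ('X)%:P * 'X).

HB.instance Definition _ := GRing.RMorphism.on dehom_hom.

Definition dehom e p : {poly k} := (dehom_hom p)`_e.

Lemma dehom_homX m :
  dehom_hom 'X_[m] = ('X ^+ (m ord_max))%:P * 'X ^+ (m ord0 + m ord_max).
Proof.
rewrite /dehom_hom mmapX /mmap1 big_ord_recl big_ord1 /=.
have -> : lift ord0 ord0 = ord_max :> 'I_2 by apply: val_inj.
by rewrite exprMn mulrCA -exprD rmorphXn.
Qed.

Lemma dehom_coef e s p : (dehom e p)`_s = if (s <= e)%N then p@_(mxy (e - s) s) else 0.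
Proof.
have termE m : (dehom_hom (p@_m *: 'X_[m]))`_e`_s =
    p@_m * ((s == m ord_max) && (e == (m ord0 + m ord_max)%N))%:R.
  rewrite -mul_mpolyC rmorphM /= [dehom_hom _%:MP]mmapC dehom_homX /=.
  rewrite mulrA -polyCM coefCM coefXn; case: eqP => _; last by rewrite mulr0 coef0 andbF mulr0.
  by rewrite mulr1 coefCM coefXn andbT.
rewrite /dehom {1}[p]mpolyE raddf_sum /= !coef_sum (eq_bigr _ (fun m _ => termE m)).
have [se|se] := leqP s e; last first.
  rewrite big1 // => m _; have -> : (s == m ord_max) && (e == (m ord0 + m ord_max)%N) = false by lia.
  by rewrite mulr0.
rewrite (eq_bigr (fun m => p@_m * (m == mxy (e - s) s)%:R)) => [|m _]; last first.
  congr (_ * (nat_of_bool _)%:R); apply/andP/eqP => [[/eqP E1 /eqP E2]|->]; last by rewrite mxy0 mxy1; lia.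
  by apply: mnm2P; rewrite (mxy0, mxy1); lia.
have [mp|mp] := boolP (mxy (e - s) s \in msupp p).
  rewrite (bigD1_seq _ mp) ?msupp_uniq //= eqxx mulr1 big1 ?addr0 // => m /negPf ->.
  by rewrite mulr0.
rewrite (memN_msupp_eq0 mp) big_seq big1 // => m mp'.
by case: eqP => [E|_]; [rewrite E (negPf mp) in mp'|rewrite mulr0].
Qed.

Lemma dehom_eq p q : (forall e, dehom e p = dehom e q) -> p = q.
Proof.
move=> E; apply/mpolyP => m; have := congr1 (fun g => g`_(m ord_max)) (E (m ord0 + m ord_max)%N).
by rewrite !dehom_coef leq_addl addnK -mxyE.
Qed.

Lemma size_dehom e p : (size (dehom e p) <= e.+1)%N.
Proof. by apply/leq_sizeP => s es; rewrite dehom_coef leqNgt es. Qed.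

Lemma dehom_is_additive e : additive (dehom e).
Proof. by move=> p q; rewrite /dehom rmorphB coefB. Qed.

HB.instance Definition _ e := GRing.isAdditive.Build A {poly k} (dehom e) (dehom_is_additive e).

Lemma dehomM e p q : dehom e (p * q) = \sum_(i < e.+1) dehom i p * dehom (e - i) q.
Proof. by rewrite /dehom rmorphM coefM. Qed.

(** Only the initial forms contribute to the lowest possible degree. *)
Lemma dehom_lowM e1 e2 p q : (forall e, (e < e1)%N -> dehom e p = 0) ->
  (forall e, (e < e2)%N -> dehom e q = 0) ->
  dehom (e1 + e2) (p * q) = dehom e1 p * dehom e2 q.
Proof.
move=> p0 q0; have le : (e1 < (e1 + e2).+1)%N by rewrite ltnS leq_addr.
rewrite dehomM (bigD1 (Ordinal le)) //= addKn big1 ?addr0 // => i.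
rewrite -(inj_eq val_inj) /= neq_ltn => /orP[/p0 ->|lt]; first by rewrite mul0r.
by rewrite q0 ?mulr0 //; have := ltn_ord i; lia.
Qed.

Definition homogenize e g : A := \sum_(s < e.+1) g`_s *: 'X_[mxy (e - s) s].

Lemma mcoeff_homogenize e g m : (homogenize e g)@_m =
  if (m ord0 + m ord_max == e)%N then g`_(m ord_max) else 0.
Proof.
rewrite /homogenize raddf_sum /=; under eq_bigr do rewrite mcoeffZ mcoeffX.
case: eqP => [E|E]; last first.
  rewrite big1 // => s _; case: eqP => [Em|]; last by rewrite mulr0.
  by case: E; rewrite -Em mxy0 mxy1 subnK // -ltnS.
have le : (m ord_max < e.+1)%N by lia.
rewrite (bigD1 (Ordinal le)) //= big1 ?addr0 => [|s sm].
  by rewrite -E addnK -mxyE eqxx mulr1.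
case: eqP => [Em|]; last by rewrite mulr0.
by case/eqP: sm; apply: val_inj; rewrite /= -Em mxy1.
Qed.

Lemma dehom_homogenize e e' g : (size g <= e.+1)%N ->
  dehom e' (homogenize e g) = if e' == e then g else 0.
Proof.
move=> ge; apply/polyP => s; rewrite dehom_coef mcoeff_homogenize mxy0 mxy1.
have [se|se] := leqP s e'.
  by rewrite subnK //; case: eqP; rewrite ?coef0.
by case: eqP => [E|_]; rewrite ?coef0 // nth_default //; apply: leq_trans ge _; rewrite -E.
Qed.

Lemma dehom_hom_homogenize e g : (size g <= e.+1)%N -> dehom_hom (homogenize e g) = g%:P * 'X^e.
Proof.
move=> ge; apply/polyP => i; rewrite -[LHS]/(dehom i _) dehom_homogenize //.
by rewrite coefCM coefXn; case: eqP; rewrite ?mulr1 ?mulr0.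
Qed.

Lemma dehom_homogenizeM e e' g p : (size g <= e.+1)%N ->
  dehom (e + e') (homogenize e g * p) = g * dehom e' p.
Proof.
move=> ge; rewrite /dehom rmorphM /= dehom_hom_homogenize //.
by rewrite mulrAC coefMXn ltnNge leq_addr /= addKn coefCM.
Qed.

Lemma homogenizeM e e' g g' : (size g <= e.+1)%N -> (size g' <= e'.+1)%N ->
  homogenize (e + e') (g * g') = homogenize e g * homogenize e' g'.
Proof.
move=> ge ge'; have gg' : (size (g * g')%R <= (e + e').+1)%N.
  apply: leq_trans (size_polyMleq _ _) _; lia.
apply: dehom_eq => i; rewrite /dehom rmorphM /= !dehom_hom_homogenize //.
by rewrite polyCM exprD mulrACA.
Qed.

Lemma homogenizeD e g g' : homogenize e (g + g') = homogenize e g + homogenize e g'.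
Proof.
by rewrite /homogenize -big_split; apply: eq_bigr => s _; rewrite /= coefD scalerDl.
Qed.

Lemma homogenize_Xn e s : (s <= e)%N -> homogenize e 'X^s = 'X_[mxy (e - s) s].
Proof.
move=> se; apply/mpolyP => m; rewrite mcoeff_homogenize mcoeffX coefXn.
case: eqP => [E|E].
  congr (nat_of_bool _)%:R; apply/eqP/eqP => [<-|<-]; last by rewrite mxy1.
  by rewrite -E addnK -mxyE.
by case: eqP => // Em; case: E; rewrite -Em mxy0 mxy1 subnK.
Qed.

End TwoVariables.

(** * Coprime members of a linear system *)

Section CoprimeElement.
Variable k : fieldType.
Hypothesis k_infinite : infinite_set [set: k].
Implicit Types f g h : {poly k}.

Lemma infinite_uniq n : exists s : seq k, uniq s /\ size s = n.
Proof.
elim: n => [|n [s [us ss]]]; first by exists [::].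
have [x xs] : exists x, x \notin s.
  apply: contrapT => none; apply: k_infinite; apply/finite_seqP; exists s.
  apply/seteqP; split=> // x _ /=; apply: contrapT => xs; apply: none.
  by exists x; apply/negP.
by exists (x :: s); rewrite /= xs us ss.
Qed.

(** The gcds of f with two members of the pencil g1 + c g2 are coprime, so only
    finitely many of them can be nontrivial divisors of f. *)
Lemma coprime_pencil f g1 g2 : f != 0 -> coprimep f (gcdp g1 g2) ->
  exists c, coprimep f (g1 + c *: g2).
Proof.
move=> f0 fg; apply: contrapT => none.
have [s [us ss]] := infinite_uniq (size f).
pose D c := gcdp f (g1 + c *: g2).
have D0 c : D c != 0 by rewrite gcdp_eq0 negb_and f0.
have D1 c : (1 < size (D c))%N.
  rewrite ltn_neqAle size_poly_gt0 D0 andbT eq_sym.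
  by apply/negP => h; apply: none; exists c; rewrite /coprimep.
have Dco c c' : c != c' -> coprimep (D c) (D c').
  move=> cc; apply/coprimepP => e eD eD'; rewrite -size_poly_eq1.
  have ef : e %| f by apply: dvdp_trans eD (dvdp_gcdl _ _).
  have e1 : e %| g1 + c *: g2 by apply: dvdp_trans eD (dvdp_gcdr _ _).
  have e2 : e %| g1 + c' *: g2 by apply: dvdp_trans eD' (dvdp_gcdr _ _).
  have eg2 : e %| g2.
    rewrite -(@dvdpZr _ (c - c')) ?subr_eq0 //.
    have -> : (c - c') *: g2 = (g1 + c *: g2) - (g1 + c' *: g2).
      by rewrite scalerBl opprD addrACA subrr add0r.
    exact: dvdp_sub.
  have eg1 : e %| g1 by rewrite -(dvdp_addl g1 (_ : e %| c *: g2)) // -mul_polyC dvdp_mull.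
  rewrite size_poly_eq1; have /coprimepP := fg; apply=> //.
  by rewrite dvdp_gcd eg1.
have prod_dvd t : uniq t -> \prod_(c <- t) D c %| f /\
    (size t < size (\prod_(c <- t) D c)%R)%N /\
    forall c, c \notin t -> coprimep (D c) (\prod_(c <- t) D c).
  elim: t => [|c t IH] /=.
    by rewrite big_nil dvd1p size_poly1; do 2!split=> //; move=> c _; apply: coprimep1.
  move=> /andP[ct /IH[tf [st tco]]]; rewrite big_cons; split; last split.
  - by rewrite Gauss_dvdp ?tco // dvdp_gcdl.
  - have P0 : \prod_(c <- t) D c != 0 by rewrite -size_poly_gt0; apply: leq_trans st.
    rewrite size_mul //; move: st (D1 c); move: (size _) (size (D c)) (size t) => x y z; lia.
  - move=> c'; rewrite inE negb_or => /andP[cc' c't].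
    by rewrite coprimepMr Dco //= tco.
have [sf [ls _]] := prod_dvd s us.
by have := dvdp_leq f0 sf; rewrite leqNgt -ss ls.
Qed.

(** Adding a general multiple of each member of l in turn to g makes the gcd as
    small as it can be. *)
Lemma coprime_in_subspace (V : set {poly k}) f :
  (forall g h, V g -> V h -> V (g + h)) -> (forall c g, V g -> V (c *: g)) ->
  V 0 -> f != 0 -> forall l : seq {poly k}, (forall g, g \in l -> V g) ->
  exists2 g, V g & forall h, h \in l -> gcdp f g %| h.
Proof.
move=> VD VZ V0 f0; elim=> [|h l IH] Vl; first by exists 0.
have [|g Vg gl] := IH; first by move=> g gl; apply: Vl; rewrite inE gl orbT.
have Vh : V h by apply: Vl; rewrite inE eqxx.
pose e := gcdp f (gcdp g h).
have e0 : e != 0 by rewrite gcdp_eq0 negb_and f0.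
have [e_f e_gh] : e %| f /\ e %| gcdp g h by rewrite dvdp_gcdl dvdp_gcdr.
have [e_g e_h] : e %| g /\ e %| h.
  by split; apply: dvdp_trans e_gh _; rewrite (dvdp_gcdl, dvdp_gcdr).
have [f' fE] := dvdpP _ _ e_f; have [g' gE] := dvdpP _ _ e_g; have [h' hE] := dvdpP _ _ e_h.
have [||c cop] := @coprime_pencil f' g' h'.
- by apply: contraNneq f0 => f'0; rewrite fE f'0 mul0r.
- apply/coprimepP => q qf' /[!dvdp_gcd]/andP[qg' qh'].
  rewrite -size_poly_eq1; have : q * e %| e.
    by rewrite {2}/e !dvdp_gcd fE gE hE !dvdp_mul2r // qf' qg'.
  rewrite -{2}[e]mul1r dvdp_mul2r // dvdp1; exact.
have ge : gcdp f (g + c *: h) %| e.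
  have -> : g + c *: h = (g' + c *: h') * e by rewrite gE hE mulrDl scalerAl.
  by rewrite fE -(eqp_dvdl _ (mulp_gcdl _ _ _)) -{2}[e]mul1r dvdp_mul2r // dvdp1.
exists (g + c *: h); first by apply: VD => //; apply: VZ.
move=> q; rewrite inE => /orP[/eqP ->|ql]; first exact: dvdp_trans ge e_h.
apply: dvdp_trans (gl q ql); rewrite dvdp_gcd dvdp_gcdl.
exact: dvdp_trans ge e_g.
Qed.

End CoprimeElement.

(** * Subspaces of polynomials with prescribed support *)

Section SupportSubspaces.
Variables (k : fieldType) (N : nat).
Implicit Types (P : pred nat) (f g : {poly k}) (v : 'rV[k]_N).

Definition suppv P : {vspace 'rV[k]_N} :=
  lker (linfun (mulmxr (diag_mx (\row_(i < N) (~~ P i)%:R)))).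

Lemma suppvP P v : reflect (forall s, (rVpoly v)`_s != 0 -> P s) (v \in suppv P).
Proof.
rewrite memv_ker lfunE /=; apply: (iffP eqP) => [E s|H].
  rewrite coef_rVpoly; case: insubP => [i _ <-|]; last by rewrite eqxx.
  move/rowP: E => /(_ i); rewrite mul_mx_diag !mxE; case: (P i) => //=.
  by rewrite mulr1 => ->; rewrite eqxx.
apply/rowP => i; rewrite mul_mx_diag !mxE.
case Pi: (P i); first by rewrite mulr0.
by rewrite mulr1; apply/eqP/negPn/negP; rewrite -coef_rVpoly_ord => /H; rewrite Pi.
Qed.

Lemma poly_rV_suppv P f : (size f <= N)%N -> (forall s, f`_s != 0 -> P s) ->
  poly_rV f \in suppv P.
Proof. by move=> fN fP; apply/suppvP; rewrite poly_rV_K. Qed.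

(** The conversion to row vectors truncates, so this is the multiplication by f only
    on polynomials of small enough size. *)
Definition mulpv f : 'End('rV[k]_N) := linfun (poly_rV \o (f \*o rVpoly)).

Lemma mulpvE f v : mulpv f v = poly_rV (f * rVpoly v).
Proof. by rewrite lfunE. Qed.

Lemma dim_mulpv f P : f != 0 ->
  (forall g, (forall s, g`_s != 0 -> P s) -> (size (f * g)%R <= N)%N) ->
  \dim (mulpv f @: suppv P) = \dim (suppv P).
Proof.
move=> f0 fP; apply: limg_dim_eq; apply/eqP; rewrite -subv0; apply/subvP => v.
rewrite memv_cap memv_ker mulpvE memv0 => /andP[/suppvP vP /eqP E].
have := congr1 rVpoly E; rewrite poly_rV_K; last exact: fP.
move/eqP; rewrite raddf0 mulf_eq0 (negPf f0) /= => /eqP v0.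
by rewrite -[v]rVpolyK v0 raddf0.
Qed.

End SupportSubspaces.

(** * Monomials in Rees algebras and generators *)

Section ReesMonomials.
Variables (A : comNzRingType) (I : set A).

Lemma rees_mono_subproof n x : ideal_pow I n x -> x *: 'X^n \in rees_pred I.
Proof.
move=> Ix; apply/asboolP => i; rewrite coefZ coefXn.
have [->|_] := eqVneq i n; rewrite ?mulr1 // mulr0.
by case: (ideal_pow_ideal I i).
Qed.

Definition rees_mono n x (Ix : ideal_pow I n x) : rees I := Rees (rees_mono_subproof Ix).

Lemma rees_mono_deg n x (Ix : ideal_pow I n x) : rees_deg n (rees_mono Ix).
Proof. by exists x. Qed.

Lemma rees_degP n (p : rees I) : rees_deg n p ->
  exists x (Ix : ideal_pow I n x), p = rees_mono Ix.
Proof.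
move=> [x E]; have Ix : ideal_pow I n x.
  by have := reesP p n; rewrite E coefZ coefXn eqxx mulr1.
by exists x, Ix; apply: val_inj.
Qed.

Lemma coef_rees_mono n x (Ix : ideal_pow I n x) i :
  (rees_poly (rees_mono Ix))`_i = if i == n then x else 0.
Proof. by rewrite coefZ coefXn; case: eqP; rewrite ?mulr1 ?mulr0. Qed.

Lemma rees_mono_inj n x y (Ix : ideal_pow I n x) (Iy : ideal_pow I n y) :
  x = y -> rees_mono Ix = rees_mono Iy.
Proof. by move=> E; apply: val_inj; rewrite /= E. Qed.

Lemma rees_monoM m n x y (Ix : ideal_pow I m x) (Iy : ideal_pow I n y) :
  rees_mono Ix * rees_mono Iy = rees_mono (ideal_powM Ix Iy).
Proof.
by apply: val_inj; rewrite rmorphM /= -scalerAl -scalerAr scalerA exprD.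
Qed.

Lemma ideal_powD n x y : ideal_pow I n x -> ideal_pow I n y -> ideal_pow I n (x + y).
Proof. by case: (ideal_pow_ideal I n) => _ aI _; apply: aI. Qed.

Lemma rees_monoD n x y (Ix : ideal_pow I n x) (Iy : ideal_pow I n y) :
  rees_mono Ix + rees_mono Iy = rees_mono (ideal_powD Ix Iy).
Proof. by apply: val_inj; rewrite raddfD /= scalerDl. Qed.

Variables (m : nat) (f : 'I_m -> rees I) (S : set A).
Hypothesis genS : I = ideal_gen S.
Hypothesis f1 : forall j, rees_deg 1 (f j).
Hypothesis fS : forall x, S x -> exists j, rees_poly (f j) = x *: 'X^1.

(** The Rees algebra is generated over A by its part of degree 1, which is I t. *)
Lemma rees_generators : @degree1_generators (rees_algebra I) m f.
Proof.
split=> //; apply/seteqP; split; first apply: ideal_gen_min.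
- exact: ideal_gen_ideal.
- by move=> _ [j _ <-]; apply: ideal_gen_sub; exists 1%N => //; apply: f1.
have iG := ideal_gen_ideal (range f); have [G0 aG mG] := iG.
have G1 : (ideal_pow I 1 `<=`
    [set x | exists2 p, ideal_gen (range f) p & rees_poly p = x *: 'X^1])%classic.
  have iK : is_ideal [set x | exists2 p, ideal_gen (range f) p & rees_poly p = x *: 'X^1]%classic.
    split.
    - by exists 0; [exact: G0|rewrite scale0r raddf0].
    - move=> x y [p Gp Ep] [q Gq Eq]; exists (p + q); first exact: aG.
      by rewrite raddfD /= Ep Eq scalerDl.
    - move=> c x [p Gp Ep]; have Ic : ideal_pow I 0 c by [].
      exists (rees_mono Ic * p); first exact: mG.
      by rewrite rmorphM /= Ep expr0 -scalerAl mul1r scalerA.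
  have [_ _ mK] := iK.
  apply: ideal_gen_min => // _ [x Ix [y _ <-]]; rewrite mulrC; apply: mK.
  have {Ix} : ideal_gen S x by rewrite -genS.
  move: x; apply: ideal_gen_min => // x /fS[j fj].
  by exists (f j) => //; apply: ideal_gen_sub; exists j.
apply: ideal_gen_min => // p [[//|n] _ pn].
have [_ gen] := rees_deg_standard I; have [l [lP ->]] := gen n p pn.
rewrite big_seq; apply: ideal_sum => // u /lP[u1 _]; rewrite mulrC; apply: mG.
have [x [Ix ->]] := rees_degP u1; have [p' Gp' Ep'] := G1 _ Ix.
by have -> : rees_mono Ix = p' by apply: val_inj.
Qed.

End ReesMonomials.

Section FiberGenerators.
Variables (k : fieldType) (I : set {mpoly k[2]}).

Lemma fiber_proj_eq (p q : rees I) :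
  fiber_proj p = fiber_proj q <-> p - q \in @fiber_pred k I.
Proof.
split=> [pq|/fiber_proj_eq0]; first by apply/fiber_proj_eq0; rewrite rmorphB /= pq subrr.
by rewrite rmorphB => /eqP; rewrite subr_eq0 => /eqP.
Qed.

Lemma fiber_generators m (f : 'I_m -> rees I) :
  @degree1_generators (rees_algebra I) m f ->
  @degree1_generators (fiber_ring I) m (fun j => fiber_proj (f j)).
Proof.
move=> [f1 fG]; split; first by move=> j; exists (f j) => //; apply: f1.
apply/seteqP; split; first apply: ideal_gen_min.
- exact: ideal_gen_ideal.
- by move=> _ [j _ <-]; apply: ideal_gen_sub; exists 1%N => //; exists (f j) => //; apply: f1.
apply: ideal_gen_min; first exact: ideal_gen_ideal.
move=> _ [n n0 [p pn <-]].
have : ideal_gen (range f) p by rewrite fG; apply: ideal_gen_sub; exists n.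
move=> /(@ideal_gen_range (rees_algebra I))[c ->].
rewrite raddf_sum; have iG := ideal_gen_ideal (range (fun j => fiber_proj (f j))).
apply: ideal_sum => // j _.
rewrite [X in ideal_gen _ X](rmorphM (@fiber_proj k I) (f j) (c j)) mulrC.
have [_ _ mG] := iG; apply: mG.
by apply: ideal_gen_sub; exists j.
Qed.

End FiberGenerators.

(** * The powers of the monomial ideal *)

Section MonomialIdeal.
Variables (k : fieldType) (a b d : nat).
Hypotheses (a_gt0 : (0 < a)%N) (le_ab : (a <= b)%N) (lt_bd : (b < d)%N).
Local Notation A := {mpoly k[2]}.
Local Notation I := (@monomial_ideal k d a b).

Section Exponents.
Local Open Scope nat_scope.

(** The n-fold sumset of {0, d} and the interval [a, b]: i terms are equal to d, j
    terms lie in [a, b] and add up to c, the others are 0. *)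
Definition sumset n s := exists i j c, [/\ i + j <= n, j * a <= c <= j * b & s = i * d + c].

Lemma sumset_le n s : sumset n s -> s <= n * d.
Proof. by move=> [i [j [c [ij /andP[_ cb] ->]]]]; nia. Qed.

Lemma sumset0 s : sumset 0 s -> s = 0.
Proof. by move/sumset_le; rewrite mul0n leqn0 => /eqP. Qed.

Lemma sumset_0 n : sumset n 0.
Proof. by exists 0, 0, 0; rewrite !mul0n. Qed.

Lemma sumset_d : sumset 1 d.
Proof. by exists 1, 0, 0; split; lia. Qed.

Lemma sumset_mid s : a <= s <= b -> sumset 1 s.
Proof. by move=> sab; exists 0, 1, s; rewrite !mul1n. Qed.

Lemma sumset1 s : sumset 1 s -> [\/ s = 0, s = d | a <= s <= b].
Proof.
move=> [[|i] [[|j] [c [ij cab ->]]]]; last by lia.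
- by constructor 1; lia.
- have j0 : j = 0 by lia.
  by constructor 3; rewrite j0 !mul1n in cab *; lia.
- have i0 : i = 0 by lia.
  by constructor 2; rewrite i0; lia.
Qed.

Lemma sumset_mono m n s : m <= n -> sumset m s -> sumset n s.
Proof. by move=> mn [i [j [c [ij cab E]]]]; exists i, j, c; split=> //; lia. Qed.

Lemma sumsetD m n s t : sumset m s -> sumset n t -> sumset (m + n) (s + t).
Proof.
move=> [i [j [c [ij cab ->]]]] [i' [j' [c' [ij' cab' ->]]]].
exists (i + i'), (j + j'), (c + c'); split; [lia| |lia].
by rewrite !mulnDl; lia.
Qed.

Lemma sumset_split n s : sumset n.+1 s ->
  exists s1 s2, [/\ sumset 1 s1, sumset n s2 & s = s1 + s2].
Proof.
move=> [[|i] [[|j] [c [ij cab ->]]]].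
- exists 0, 0; split; try exact: sumset_0; move: cab; rewrite !mul0n; lia.
- exists (c - minn (c - a) (j * b)), (minn (c - a) (j * b)); split; last by lia.
    apply: sumset_mid; rewrite !mulSn in cab; nia.
  by exists 0, j, (minn (c - a) (j * b)); split; [lia| |lia]; rewrite !mulSn in cab; nia.
- by exists d, (i * d + c); split; [exact: sumset_d| exists i, 0, c; split=> //; lia|lia].
- by exists d, (i * d + c); split; [exact: sumset_d| exists i, j.+1, c; split=> //; lia|lia].
Qed.

(** If the sum s + t d uses at least t terms d, remove them. Otherwise it is small,
    which bounds s by n b, and then n - i terms of [a, b] are enough for the part c
    of s = i d + c. *)
Lemma sumset_saturated n t s :
  sumset (n + t) s -> sumset (n + t) (s + t * d) -> sumset n s.
Proof.
move=> [i [j [c [ij cab E]]]] [i' [j' [c' [ij' cab' E']]]].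
have [ti|it] := leqP t i'.
  exists (i' - t), j', c'; split=> //; first by lia.
  by rewrite mulnBl; nia.
have [ijn|nij] := leqP (i + j) n; first by exists i, j, c.
have hs : s + (t - i') * d <= (n + (t - i')) * b.
  have -> : n + (t - i') = n + t - i' by lia.
  have := leq_mul2r d i' t; rewrite (ltnW it) orbT mulnBl => h.
  by have : j' * b <= (n + t - i') * b by [rewrite leq_mul2r; lia]; lia.
have {}hs : s <= n * b by rewrite mulnDl in hs; nia.
have ni : i <= n by rewrite leqNgt; apply/negP => ni; nia.
exists i, (n - i), c; split=> //; first by lia.
by rewrite !mulnBl; nia.
Qed.

(** The monomial x^al y^be is divisible by x^(n d - s) y^s for some s in the n-fold
    sumset, that is, lies in I^n. *)
Definition in_pow n al be := exists s, [/\ sumset n s, s <= be & n * d <= s + al].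

Lemma in_pow_mono n al be al' be' : in_pow n al be -> in_pow n (al + al') (be + be').
Proof. by move=> [s [sn sb sa]]; exists s; split=> //; lia. Qed.

Lemma in_pow_ge n al be : in_pow n al be -> n * d <= al + be.
Proof. by move=> [s [sn sb sa]]; lia. Qed.

Lemma in_pow_sumset n s : sumset n s -> in_pow n (n * d - s) s.
Proof. by move=> sn; have := sumset_le sn; exists s; split=> //; lia. Qed.

Lemma in_pow_eq n al be : al + be = n * d -> in_pow n al be -> sumset n be.
Proof. by move=> E [s [sn sb sa]]; have -> : be = s by lia. Qed.

Lemma in_powM m n al be al' be' :
  in_pow m al be -> in_pow n al' be' -> in_pow (m + n) (al + al') (be + be').
Proof.
move=> [s [sn sb sa]] [s' [sn' sb' sa']]; exists (s + s'); split; try lia.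
exact: sumsetD.
Qed.

(** If neither hypothesis gives the conclusion at once, the first one comes from
    n + 1 terms, and the second one from terms other than d. The latter forces al
    to be so large that one term can be left out of the former. *)
Lemma in_pow_descent n al be :
  in_pow n.+1 (al + d) be -> in_pow n.+1 al (be + d) -> in_pow n al be.
Proof.
move=> [s [[i [j [c [ij cab E]]]] sb sa]] [s' [[i' [j' [c' [ij' cab' E']]]] sb' sa']].
have [ijn|nij] := leqP (i + j) n; first by exists s; split; [exists i, j, c|lia|lia].
case: i' => [|i'] in ij' E' *; last first.
  by exists (s' - d); split; [exists i', j', c'; split=> //; lia|lia|lia].
have hs : n.+1 * d <= n.+1 * b + al by nia.
case: j => [|j] in ij cab E nij *.
  exists (n * d); split; last by lia.
    by exists n, 0, 0; rewrite !mul0n; split; lia.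
  have ni : n.+1 = i by lia.
  by rewrite E -ni in sb; lia.
exists (i * d + minn c (j * b)); split.
- by exists i, j, (minn c (j * b)); split=> //; [lia|rewrite !mulSn in cab; nia].
- by lia.
- have ni : n = i + j by lia.
  rewrite /minn; case: ifP => _; first by rewrite -E; lia.
  by rewrite ni; rewrite ni in hs; nia.
Qed.

(** The two cases are those of a multiple of x^d and of y^d; see [spans_reducing]. *)
Definition reducing n := forall s, sumset n.+1 s ->
  sumset n s \/ exists2 s', sumset n s' & s = s' + d.

(** For a = b the sum of d + 1 terms a is also that of a terms d and one term a. For
    a < b, the interval of sums of d terms of [a, b] and its translate by d cover
    the interval of sums of d + 1 terms. *)
Lemma reducing_d : reducing d.
Proof.
move=> s [i [j [c [ij cab E]]]].
case: i => [|i] in ij E *; last first.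
  by right; exists (i * d + c); [exists i, j, c|lia].
have [jd|dj] := leqP j d; first by left; exists 0, j, c.
have {ij dj} jd : j = d.+1 by lia.
rewrite {}jd !mulSn in cab; rewrite mul0n add0n in E.
have [ab|ab] := ltnP a b; last first.
  have {}ab : b = a by lia.
  by left; exists a, 1, a; split; [lia|lia|rewrite ab in cab; lia].
have [cd|dc] := leqP c (d * b); first by left; exists 0, d, c; split; lia.
right; exists (c - d); last by nia.
by exists 0, d, (c - d); split; [lia|nia|lia].
Qed.

Lemma not_reducing0 : ~ reducing 0.
Proof.
move=> /(_ a) []; first by apply: sumset_mid; lia.
  by move/sumset0; lia.
by move=> [s _]; lia.
Qed.

Lemma reducingS n : reducing n -> reducing n.+1.
Proof.
move=> rn s /sumset_split[s1 [s2 [s11 /rn s2n ->]]].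
case: s2n => [s2n|[s' s'n ->]]; first by left; rewrite -addn1 addnC; apply: sumsetD.
by right; exists (s1 + s'); [rewrite -addn1 addnC; apply: sumsetD|lia].
Qed.

Lemma reducing_le m n : m <= n -> reducing m -> reducing n.
Proof. by move=> mn rm; rewrite -(subnK mn); elim: (n - m) => // l; apply: reducingS. Qed.

End Exponents.

Implicit Types (p q : A) (f g h c : {poly k}).

Lemma generator_monomial s : sumset 1 s -> I 'X_[mxy (d - s) s].
Proof.
case/sumset1 => [->|->|sab]; apply: ideal_gen_sub; rewrite mpolyXxy.
- by left; left; rewrite subn0 expr0 mulr1.
- by left; right; rewrite subnn expr0 mul1r.
- by right; exists s.
Qed.

Lemma ideal_pow_monomial n al be : in_pow n al be -> ideal_pow I n 'X_[mxy al be].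
Proof.
elim: n al be => [//|n IH] al be [s [/sumset_split[s1 [s2 [s11 s2n ->]]] sb sa]].
have s1d := sumset_le s11; have s2d := sumset_le s2n.
have -> : mxy al be = (mxy (d - s1) s1 + mxy (al - (d - s1)) (be - s1))%MM.
  by rewrite mxyD; congr mxy; lia.
rewrite mpolyXD; apply: ideal_mulP; first exact: generator_monomial.
by apply: IH; exists s2; split=> //; lia.
Qed.

(** Membership in a monomial ideal is a condition on each monomial. *)
Lemma ideal_powP n p : ideal_pow I n p <-> supp_in (in_pow n) p.
Proof.
split; last first.
  by apply: ideal_supp; [exact: ideal_pow_ideal|exact: ideal_pow_monomial].
elim: n p => [|n IH] p.
  by move=> _ m _; exists 0%N; split=> //; apply: sumset_0.
have I1 : (I `<=` supp_in (in_pow 1))%classic.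
  apply: ideal_gen_min; first by apply: supp_in_ideal; apply: in_pow_mono.
  have mono s : sumset 1 s -> supp_in (in_pow 1) ('X_ord0 ^+ (d - s) * 'X_ord_max ^+ s : A).
    by move=> s1; rewrite -mpolyXxy; apply: supp_in_X; have := in_pow_sumset s1; rewrite mul1n.
  move=> q [[->|->]|[s sab <-]].
  - by have := mono _ (sumset_0 1); rewrite subn0 expr0 mulr1.
  - by have := mono _ sumset_d; rewrite subnn expr0 mul1r.
  - by apply: mono; apply: sumset_mid.
move: p; apply: ideal_gen_min; first by apply: supp_in_ideal; apply: in_pow_mono.
move=> _ [p /I1 Ip [q /IH Iq <-]]; apply: (supp_inM _ Ip Iq) => *.
by rewrite -add1n; apply: in_powM.
Qed.

Lemma max_ideal_powP n p : ideal_mul (@max_ideal k) (ideal_pow I n) p <->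
  supp_in (fun al be => in_pow n al be /\ (n * d < al + be)%N) p.
Proof.
split.
  have up al be al' be' : in_pow n al be /\ (n * d < al + be)%N ->
      in_pow n (al + al') (be + be') /\ (n * d < al + al' + (be + be'))%N.
    by case=> h1 h2; split; [apply: in_pow_mono|lia].
  have m1 : (@max_ideal k `<=` supp_in (fun al be => (0 < al + be)%N))%classic.
    apply: ideal_gen_min; first by apply: supp_in_ideal => *; lia.
    move=> q [->|->].
      have -> : 'X_ord0 = 'X_[mxy 1 0] :> A by rewrite mpolyXxy expr0 mulr1.
      by apply: supp_in_X.
    have -> : 'X_ord_max = 'X_[mxy 0 1] :> A by rewrite mpolyXxy expr0 mul1r.
    by apply: supp_in_X.
  move: p; apply: ideal_gen_min; first exact: supp_in_ideal.
  move=> _ [p /m1 mp [q /ideal_powP Iq <-]]; apply: (supp_inM _ mp Iq) => al be al' be' h h'.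
  by split; [rewrite ![(al + _)%N]addnC ![(be + _)%N]addnC; apply: in_pow_mono|have := in_pow_ge h'; lia].
apply: ideal_supp; first exact: ideal_gen_ideal.
move=> al be [[s [sn sb sa]] deg].
have gens (z : A) : [set 'X_ord0; 'X_ord_max]%classic z -> @max_ideal k z by exact: ideal_gen_sub.
have [lt|ge] := ltnP s be.
  have -> : 'X_[mxy al be] = 'X_ord_max * 'X_[mxy al be.-1] :> A.
    by rewrite !mpolyXxy mulrCA -exprS prednK //; lia.
  apply: ideal_mulP; first by apply: gens; right.
  by apply: ideal_pow_monomial; exists s; split=> //; lia.
have -> : 'X_[mxy al be] = 'X_ord0 * 'X_[mxy al.-1 be] :> A.
  rewrite !mpolyXxy mulrA -exprS prednK //; have := sumset_le sn; lia.
apply: ideal_mulP; first by apply: gens; left.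
by apply: ideal_pow_monomial; exists s; split=> //; have := sumset_le sn; lia.
Qed.

(** The image of the degree-n part of the fiber ring in k[T]. *)
Definition inF n g := forall s, g`_s != 0 -> sumset n s.

Lemma inF_size n g : inF n g -> (size g <= (n * d).+1)%N.
Proof.
move=> gn; apply/leq_sizeP => s ns; apply/eqP; apply: contraTT ns => /gn/sumset_le.
by rewrite -leqNgt.
Qed.

Lemma inF_size1 g : inF 1 g -> (size g <= d.+1)%N.
Proof. by move/inF_size; rewrite mul1n. Qed.

Lemma inF0 n : inF n 0.
Proof. by move=> s; rewrite coef0 eqxx. Qed.

Lemma inFD n f g : inF n f -> inF n g -> inF n (f + g).
Proof.
move=> fn gn s; rewrite coefD; have [->|/fn //] := eqVneq f`_s 0.
by rewrite add0r; apply: gn.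
Qed.

Lemma inFZ n (x : k) f : inF n f -> inF n (x *: f).
Proof.
by move=> fn s; rewrite coefZ; have [->|/fn //] := eqVneq f`_s 0; rewrite mulr0 eqxx.
Qed.

Lemma inFM m n f g : inF m f -> inF n g -> inF (m + n) (f * g).
Proof.
move=> fm gn s; rewrite coefM => /eqP nz.
have [i] : exists i : 'I_s.+1, f`_i * g`_(s - i) != 0.
  apply: contra_notP nz => none; rewrite big1 // => i _.
  by apply/eqP/negPn/negP => h; apply: none; exists i.
rewrite mulf_eq0 negb_or => /andP[/fm fi /gn gi].
by have := sumsetD fi gi; rewrite subnKC // -ltnS.
Qed.

Lemma inF_Xn n s : sumset n s -> inF n 'X^s.
Proof. by move=> sn i; rewrite coefXn; case: (i =P s) => [->|_]; rewrite ?eqxx. Qed.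

Lemma dehom_pow_low n p e : ideal_pow I n p -> (e < n * d)%N -> dehom e p = 0.
Proof.
move=> /ideal_powP Ip en; apply/polyP => s; rewrite coef0 dehom_coef.
case: leqP => // se; apply/eqP/negPn/negP => /Ip; rewrite mxy0 mxy1.
by move/in_pow_ge; lia.
Qed.

Lemma dehom_pow n p : ideal_pow I n p -> inF n (dehom (n * d) p).
Proof.
move=> /ideal_powP Ip s; rewrite dehom_coef; case: leqP => [se|]; last by rewrite eqxx.
by move/Ip; rewrite mxy0 mxy1; apply: in_pow_eq; rewrite subnK.
Qed.

Lemma homogenize_pow n g : inF n g -> ideal_pow I n (homogenize (n * d) g).
Proof.
move=> gn; apply/ideal_powP => m; rewrite mcoeff_homogenize.
case: (_ =P (n * d)%N) => [E|]; last by rewrite eqxx.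
by move=> /gn/in_pow_sumset; rewrite -E addnK.
Qed.

Lemma ideal_pow1 : ideal_pow I 1 = I.
Proof.
apply/seteqP; split; first apply: ideal_gen_min.
- exact: ideal_gen_ideal.
- by move=> _ [p Ip [q _ <-]]; rewrite mulrC; have [_ _ mI] : is_ideal I := ideal_gen_ideal _; apply: mI.
- by move=> p Ip; rewrite -[p]mulr1; apply: ideal_mulP.
Qed.

(** f and g generate the part of degree n + 1 of the fiber ring over its part of
    degree n. *)
Definition spans f g n := forall h, inF n.+1 h ->
  exists s t, [/\ inF n s, inF n t & h = f * s + g * t].

Lemma spans_Xn f g n :
  (forall s, sumset n.+1 s -> exists s1 t, [/\ inF n s1, inF n t & 'X^s = f * s1 + g * t]) ->
  spans f g n.
Proof.
move=> H h hn; rewrite -[h]coefK poly_def.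
apply: (big_ind (fun e => exists s t, [/\ inF n s, inF n t & e = f * s + g * t])) => [||i _].
- by exists 0, 0; rewrite !mulr0 addr0; split=> //; apply: inF0.
- move=> _ _ [s [t [sn tn ->]]] [s' [t' [sn' tn' ->]]]; exists (s + s'), (t + t').
  by split; [apply: inFD|apply: inFD|ring].
have [->|nz] := eqVneq h`_i 0.
  by exists 0, 0; rewrite scale0r !mulr0 addr0; split=> //; apply: inF0.
have [s [t [sn tn ->]]] := H i (hn i nz); exists (h`_i *: s), (h`_i *: t).
by split; [apply: inFZ|apply: inFZ|rewrite scalerDr !scalerAr].
Qed.

Lemma spans_reducing n : spans 'X^d 1 n <-> reducing n.
Proof.
split=> [H s sn|H].
  have [f [g [fn gn /(congr1 (fun h : {poly k} => h`_s))]]] := H _ (inF_Xn sn).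
  rewrite coefXn eqxx coefD mul1r coefXnM; case: ltnP => [sd|ds].
    rewrite add0r => E; left; apply: gn; by rewrite -E oner_eq0.
  move=> E; have [g0|/gn] := eqVneq g`_s 0; last by left.
  right; exists (s - d)%N; last by rewrite subnK.
  by apply: fn; rewrite g0 addr0 in E; rewrite -E oner_eq0.
apply: spans_Xn => s /H[sn|[s' sn ->]].
  exists 0, 'X^s; rewrite mulr0 add0r mul1r; split=> //; [exact: inF0|exact: inF_Xn].
exists 'X^s', 0; rewrite mulr0 addr0 -exprD addnC; split=> //; [exact: inF_Xn|exact: inF0].
Qed.

(** Both sides can be tested on forms of degree (n+1)d, since I^(n+1) is
    generated by them. *)
Lemma ideal_pow_spans f g n : inF 1 f -> inF 1 g ->
  ideal_pow I n.+1 =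
    ideal_mul (ideal_gen [set homogenize d f; homogenize d g]%classic) (ideal_pow I n) <->
  spans f g n.
Proof.
move=> f1 g1; have fs := inF_size1 f1; have gs := inF_size1 g1.
split=> [E h hn|H].
  have := homogenize_pow hn; rewrite E => /(ideal_mul_gen2 (ideal_pow_ideal I n)).
  move=> [s [t [sn tn /(congr1 (dehom (d + n * d)))]]].
  rewrite -{1}mulSn dehom_homogenize ?inF_size // eqxx raddfD /= !dehom_homogenizeM // => ->.
  by exists (dehom (n * d) s), (dehom (n * d) t); split=> //; apply: dehom_pow.
have fgI q : [set homogenize d f; homogenize d g]%classic q -> I q.
  have h1 h : inF 1 h -> I (homogenize d h).
    by move/homogenize_pow; rewrite ideal_pow1 mul1n.
  by move=> [->|->]; apply: h1.
apply/seteqP; split=> p; last first.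
  apply: ideal_gen_min; first exact: ideal_pow_ideal.
  move=> _ [q Jq [q' Iq' <-]]; apply: ideal_mulP => //.
  by move: Jq; apply: ideal_gen_min => //; apply: ideal_gen_ideal.
move/ideal_powP; apply: ideal_supp; first exact: ideal_gen_ideal.
set K := ideal_mul _ _; have [_ aK mK] : is_ideal K by apply: ideal_gen_ideal.
move=> al be [s [sn sb sa]].
have sd := sumset_le sn.
have -> : 'X_[mxy al be] = 'X_[mxy (s + al - n.+1 * d) (be - s)] * homogenize (n.+1 * d) 'X^s :> A.
  by rewrite homogenize_Xn // -mpolyXD mxyD; congr ('X_[mxy _ _]); lia.
apply: mK; have [t [t' [tn tn' ->]]] := H _ (inF_Xn sn).
rewrite homogenizeD mulSn !homogenizeM ?inF_size //.
by apply: aK; apply: ideal_mulP; try exact: homogenize_pow; apply: ideal_gen_sub; [left|right].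
Qed.

(** Let s be an exponent of c, and e whichever of f and g does not vanish at 0. By
    induction on s, either s is a sum of an exponent of e and of a smaller exponent
    of c, or it is an exponent of e c: in both cases it lies in some sumset. The
    same argument from the other end, with the coefficient of f in degree d, gives
    the other condition of [sumset_saturated]. *)
Lemma inF_descent n f g c : inF 1 f -> inF 1 g -> f`_d != 0 ->
  f`_0 != 0 \/ g`_0 != 0 -> inF n.+1 (f * c) -> inF n.+1 (g * c) -> inF n c.
Proof.
move=> f1 g1 fd fg0 fc gc.
have bottom s : c`_s != 0 -> exists t, sumset t s.
  have [e [e1 e0 ec]] : exists e, [/\ inF 1 e, e`_0 != 0 & inF n.+1 (e * c)].
    by case: fg0 => e0; [exists f; split; [exact: f1|exact: e0|exact: fc]
                     |exists g; split; [exact: g1|exact: e0|exact: gc]].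
  elim/ltn_ind: s => s IH cs.
  have := ec s; rewrite coefM big_ord_recl /= subn0.
  have [z|nz] := eqVneq (\sum_(i < s) e`_(bump 0 i) * c`_(s - bump 0 i)) 0.
    by rewrite z addr0 mulf_neq0 // => /(_ isT); exists n.+1.
  have [i] : exists i : 'I_s, e`_i.+1 * c`_(s - i.+1) != 0.
    apply: contra_neqP nz => none; rewrite big1 // => i _.
    by apply/eqP/negPn/negP => h'; apply: none; exists i.
  rewrite mulf_eq0 negb_or => /andP[/e1 ei ci] _.
  have lt : (s - i.+1 < s)%N by have := ltn_ord i; lia.
  have [t tn] := IH _ lt ci; exists (1 + t)%N.
  by have := sumsetD ei tn; rewrite subnKC.
have top s : c`_s != 0 -> exists t, sumset (n + t) (s + t * d).
  elim/ltn_ind: {s}(size c - s)%N {-2}s (erefl (size c - s)%N) => l IH s ls cs.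
  have sc : (s < size c)%N by rewrite ltnNge; apply: contra cs => le; rewrite nth_default.
  have := fc (s + d)%N; rewrite coefM.
  have le : (d < (s + d).+1)%N by lia.
  rewrite (bigD1 (Ordinal le)) //= addnK.
  set X := \sum_(i < _ | _) _; have [->|nz] := eqVneq X 0.
    by rewrite addr0 mulf_neq0 // => /(_ isT) h'; exists 1%N; rewrite addn1 mul1n.
  have [i [id]] : exists i : 'I_(s + d).+1, i != d :> nat /\ f`_i * c`_(s + d - i) != 0.
    apply: contra_neqP nz => none; rewrite /X big1 // => i id.
    by apply/eqP/negPn/negP => h'; apply: none; exists i.
  rewrite mulf_eq0 negb_or => /andP[/f1 fi ci] _.
  have lid := sumset_le fi.
  (* The exponent s + d - i of c is larger than s, as i < d. *)
  have [||//|t tn] := IH (size c - (s + d - i))%N _ (s + d - i)%N; try lia.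
  exists t.+1; have := sumsetD fi tn; rewrite addnCA add1n addnS.
  by congr (sumset _ _); lia.
move=> s cs; have [t tn] := bottom s cs; have [t' tn'] := top s cs.
apply: (@sumset_saturated n (t + t')%N).
  by apply: sumset_mono tn; lia.
have := sumsetD tn' (_ : sumset t (t * d)).
rewrite -addnA -addnA -mulnDl [(t' + t)%N]addnC; apply.
by exists t, 0%N, 0%N; split; lia.
Qed.

(** * Reductions generated by two coprime forms *)

(** The forms with dehomogenizations f and g have no common zero on the projective
    line, the point at infinity being excluded by the coefficient of f. *)
Definition parameters f g :=
  [/\ inF 1 f, inF 1 g, f`_d != 0 & coprimep f g].

Lemma parameters_Xn : parameters 'X^d 1.
Proof.
split; [exact/inF_Xn/sumset_d|exact: (@inF_Xn 1 0 (sumset_0 _))| |].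
  by rewrite coefXn eqxx oner_eq0.
exact: coprimep1.
Qed.

Lemma inFS n f g : inF 1 f -> inF n g -> inF n.+1 (f * g).
Proof. by rewrite -add1n; apply: inFM. Qed.

Section Degree.
Variable n : nat.
Local Notation N := (n.+1 * d).+1.

Definition piece m : {vspace 'rV[k]_N} := suppv k N (fun s => `[< sumset m s >]).

(** The piece of degree n - 1, which is zero for n = 0. *)
Definition lower_piece : {vspace 'rV[k]_N} :=
  suppv k N (fun s => (0 < n)%N && `[< sumset n.-1 s >]).

Lemma pieceP m v : reflect (inF m (rVpoly v)) (v \in piece m).
Proof. by apply: (iffP (suppvP _ _)) => H s /H/asboolP. Qed.

Lemma poly_rV_piece m f : (size f <= N)%N -> inF m f -> poly_rV f \in piece m.
Proof. by move=> fN fm; apply: poly_rV_suppv => // s /fm/asboolP. Qed.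

Lemma parameters_neq0 f g : parameters f g -> f != 0 /\ g != 0.
Proof.
case=> f1 _ fd fg; have f0 : f != 0 by apply: contraNneq fd => ->; rewrite coef0.
split=> //; apply: contraTneq fg => ->; rewrite coprimep0 -size_poly_eq1.
apply: contraNneq fd => f1s; rewrite nth_default // f1s; lia.
Qed.

(** f F_n and g F_n meet in f g F_(n-1): by coprimality a common element is f g c,
    and [inF_descent] applies to c. *)
Lemma span_dim f g : parameters f g ->
  \dim (mulpv N f @: piece n + mulpv N g @: piece n) + \dim lower_piece =
  (\dim (piece n)).*2.
Proof.
move=> fg; have [f0 g0] := parameters_neq0 fg; case: (fg) => f1 g1 fd fgC.
have dim1 h : inF 1 h -> h != 0 -> \dim (mulpv N h @: piece n) = \dim (piece n).
  move=> h1 h0; apply: dim_mulpv => // c cn.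
  apply: inF_size => //; apply: inFS => // s /cn/asboolP; exact.
rewrite -addnn -{1}(dim1 f) // -(dim1 g) // -dimv_sum_cap; congr addn.
have sfg c : (forall s, c`_s != 0 -> (0 < n)%N && `[< sumset n.-1 s >]) ->
    (0 < n)%N \/ c = 0.
  have [n0|_] := posnP n; last by left.
  move=> H; right; apply/polyP => s; rewrite coef0; apply/eqP/negPn/negP => /H.
  by rewrite n0.
have cF c : (forall s, c`_s != 0 -> (0 < n)%N && `[< sumset n.-1 s >]) ->
    inF n.-1 c by move=> H s /H/andP[_ /asboolP].
have inFf h c : inF 1 h -> (0 < n)%N -> inF n.-1 c -> inF n (h * c).
  by move=> h1 n0 cn; rewrite -(prednK n0); apply: inFS.
rewrite -(@dim_mulpv k N (f * g)) ?mulf_neq0 //; last first.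
  move=> c H; case: (sfg c H) => [n0|->]; last by rewrite mulr0 size_poly0.
  rewrite -mulrA; apply: inF_size => //; apply: inFS => //.
  exact/inFf/cF.
congr (\dim _); apply/eqP; rewrite eqEsubv; apply/andP; split; last first.
  apply/subvP => w; rewrite memv_cap => /andP[/memv_imgP[s /pieceP sn ->] /memv_imgP[t /pieceP tn]].
  rewrite !mulpvE => /(congr1 rVpoly); rewrite !poly_rV_K; first last.
  - by apply: inF_size => //; apply: inFS.
  - by apply: inF_size => //; apply: inFS.
  set p := rVpoly s in sn *; set q := rVpoly t in tn * => E.
  have : g %| f * p by rewrite E dvdp_mulr.
  rewrite Gauss_dvdpr; last by rewrite coprimep_sym.
  move=> /dvdpP[c pc]; have qc : q = f * c.
    by apply: (mulfI g0); rewrite -E pc; ring.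
  have cP : forall s, c`_s != 0 -> (0 < n)%N && `[< sumset n.-1 s >].
    have [n0|n0] := posnP n.
      have f2 : (d < size f)%N.
        by rewrite ltnNge; apply: contra fd => h; rewrite nth_default.
      have c0 : c = 0.
        have sq : (size q <= 1)%N.
          by apply: leq_trans (inF_size tn) _; nia.
        apply/eqP; apply: contraTT sq => c0; rewrite -ltnNge qc size_mul //.
        have d0 : (0 < d)%N := leq_ltn_trans (leq0n b) lt_bd.
        rewrite (polySpred c0) addnS /=.
        exact: leq_trans (leq_ltn_trans d0 f2) (leq_addr _ _).
      by move=> i; rewrite c0 coef0 eqxx.
    move=> i ci; apply/andP; split=> //; apply/asboolP; move: i ci.
    apply: (@inF_descent n.-1 f g c) => //.
    - have [f00|] := eqVneq f`_0 0; last by left.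
      right; apply: contraTneq fgC => g00; apply/coprimepPn; first by [].
      exists ('X - 0%:P).
      by rewrite dvdp_gcd !dvdp_XsubCl /root !horner_coef0 f00 g00 eqxx -size_poly_eq1 size_XsubC.
    - by rewrite prednK // -qc.
    - by rewrite prednK // mulrC -pc.
  apply/memv_imgP; exists (poly_rV c).
    apply: poly_rV_suppv => //.
    case: (sfg c cP) => [n0|->]; last by rewrite size_poly0.
    by apply: leq_trans (inF_size (cF c cP)) _; nia.
  rewrite mulpvE poly_rV_K; first by congr poly_rV; rewrite pc; ring.
  case: (sfg c cP) => [n0|->]; last by rewrite size_poly0.
  by apply: leq_trans (inF_size (cF c cP)) _; nia.
apply/subvP => w /memv_imgP[v /suppvP vP ->]; rewrite mulpvE memv_cap.
case: (sfg _ vP) => [n0|->]; last by rewrite mulr0 raddf0 !mem0v.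
have vF := cF _ vP.
apply/andP; split; apply/memv_imgP.
  exists (poly_rV (g * rVpoly v)).
    by apply: poly_rV_piece; [apply: leq_trans (inF_size (inFf _ _ g1 n0 vF)) _; nia|exact: inFf].
  rewrite mulpvE poly_rV_K ?mulrA //.
  by apply: leq_trans (inF_size (inFf _ _ g1 n0 vF)) _; nia.
exists (poly_rV (f * rVpoly v)).
  by apply: poly_rV_piece; [apply: leq_trans (inF_size (inFf _ _ f1 n0 vF)) _; nia|exact: inFf].
rewrite mulpvE poly_rV_K ?mulrA; first by rewrite [g * f]mulrC.
by apply: leq_trans (inF_size (inFf _ _ f1 n0 vF)) _; nia.
Qed.

(** The right-hand side does not mention f and g. *)
Lemma spans_dim f g : parameters f g ->
  spans f g n <-> \dim (piece n.+1) + \dim lower_piece = (\dim (piece n)).*2.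
Proof.
move=> fg; rewrite -(span_dim fg); case: (fg) => f1 g1 _ _.
set V := (_ + _)%VS.
have mul1 h v : inF 1 h -> v \in piece n -> inF n.+1 (h * rVpoly v).
  by move=> h1 /pieceP vn; apply: inFS.
have sz h : inF n.+1 h -> (size h <= N)%N by apply: inF_size.
have VU : (V <= piece n.+1)%VS.
  have mulV h : inF 1 h -> (mulpv N h @: piece n <= piece n.+1)%VS.
    move=> h1; apply/subvP => w /memv_imgP[v vn ->]; rewrite mulpvE.
    by apply: poly_rV_piece; [apply: sz; apply: mul1|apply: mul1].
  by rewrite subv_add !mulV.
have spansE : spans f g n <-> (piece n.+1 <= V)%VS.
  split=> [H|/subvP H h hn].
    apply/subvP => w /pieceP /H[s [t [sn tn E]]].
    have psz c : inF n c -> (size c <= N)%N.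
      by move=> cn; apply: leq_trans (inF_size cn) _ => //; nia.
    rewrite -[w]rVpolyK E raddfD /=; apply: memv_add; apply/memv_imgP.
      by exists (poly_rV s); [apply: poly_rV_piece => //; apply: psz|rewrite mulpvE poly_rV_K // psz].
    by exists (poly_rV t); [apply: poly_rV_piece => //; apply: psz|rewrite mulpvE poly_rV_K // psz].
  have := H _ (poly_rV_piece (sz _ hn) hn) => /memv_addP[_ /memv_imgP[s sn ->] [_ /memv_imgP[t tn ->] E]].
  exists (rVpoly s), (rVpoly t); split; [exact/pieceP|exact/pieceP|].
  have := congr1 rVpoly E; rewrite poly_rV_K ?sz // => ->.
  by rewrite raddfD /= !mulpvE !poly_rV_K //; apply: sz; apply: mul1.
rewrite spansE; split=> [UV|/addIn E].
  by congr addn; apply/eqP; rewrite eqn_leq !dimvS.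
have : (V == piece n.+1)%VS by rewrite eqEdim VU E leqnn.
by move/eqP => ->.
Qed.

End Degree.

(** The pair y^d, x^d is one choice of parameters. *)
Lemma spans_parameters f g n : parameters f g ->
  spans f g n <-> reducing n.
Proof.
move=> /spans_dim ->; rewrite -(spans_dim n parameters_Xn).
exact: spans_reducing.
Qed.

(** * The pair x^d, y^d in the Rees algebra and the fiber ring *)

Local Notation xd := ('X_[mxy d 0] : A).
Local Notation yd := ('X_[mxy 0 d] : A).

Lemma xd_pow : ideal_pow I 1 xd.
Proof. by apply: ideal_pow_monomial; have := in_pow_sumset (sumset_0 1); rewrite mul1n subn0. Qed.

Lemma yd_pow : ideal_pow I 1 yd.
Proof. by apply: ideal_pow_monomial; have := in_pow_sumset sumset_d; rewrite mul1n subnn. Qed.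

Lemma coefM_monomial p al be m : (p * 'X_[mxy al be])@_m != 0 ->
  exists2 m', p@_m' != 0 & m = (m' + mxy al be)%MM.
Proof.
move=> /mcoeffM_neq0[m1 [m2 [h1 + ->]]]; rewrite mcoeffX.
by case: (mxy al be =P m2) => [<- _|_]; [exists m1|rewrite eqxx].
Qed.

(** Regularity of the pair x^d, y^d on the Rees algebra (D always true) and,
    reading only coefficients of degree at most (n+2)d, on the fiber ring. *)
Lemma xy_descent (D : nat -> Prop) n p q : ideal_pow I n.+1 p -> ideal_pow I n.+1 q ->
  (forall m : 'X_{1..2}, D (m ord0 + m ord_max)%N -> (p * yd - q * xd)@_m = 0) ->
  exists2 w, ideal_pow I n w &
    forall m : 'X_{1..2}, D (m ord0 + m ord_max + d)%N -> (p - xd * w)@_m = 0.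
Proof.
move=> /ideal_powP Ip /ideal_powP Iq E.
have low (m : 'X_{1..2}) : p@_m != 0 -> D (m ord0 + m ord_max + d)%N ->
    (d <= m ord0)%N /\ in_pow n (m ord0 - d) (m ord_max).
  move=> pm Dm; have := E (m + mxy 0 d)%MM.
  rewrite mnmD_mxy0 mnmD_mxy1 addn0 addnA => /(_ Dm).
  rewrite mcoeffB [X in (p * _)@_X]addmC mcoeffMX => /eqP; rewrite subr_eq0 => /eqP pq.
  have : (q * xd)@_(m + mxy 0 d) != 0 by rewrite -pq.
  move=> /coefM_monomial[m' /Iq qm' Em].
  have /= := congr1 (fun m : 'X_{1..2} => m ord0) Em.
  have /= := congr1 (fun m : 'X_{1..2} => m ord_max) Em.
  rewrite !mnmD_mxy0 !mnmD_mxy1 !addn0 => E1 E0.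
  rewrite E0 leq_addl addnK; split=> //; apply: in_pow_descent.
    by have := Ip m pm; rewrite E0.
  by rewrite E1.
pose w := \sum_(m <- msupp p | `[< D (m ord0 + m ord_max + d)%N >])
  p@_m *: ('X_[mxy (m ord0 - d) (m ord_max)] : A).
exists w => [|m Dm].
  rewrite /w big_seq_cond; apply: ideal_sum; first exact: ideal_pow_ideal.
  move=> m /andP[mp /asboolP Dm]; rewrite -mul_mpolyC.
  have [_ _ mI] := ideal_pow_ideal I n; apply/mI/ideal_pow_monomial.
  by case: (low m) => //; rewrite -mcoeff_msupp.
have -> : xd * w = \sum_(m <- msupp p | `[< D (m ord0 + m ord_max + d)%N >]) p@_m *: 'X_[m].
  rewrite /w mulr_sumr big_seq_cond [RHS]big_seq_cond.
  apply: eq_bigr => m' /andP[mp /asboolP Dm'].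
  rewrite -scalerAr -mpolyXD mxyD add0n subnKC -?mxyE //.
  by case: (low m') => //; rewrite -mcoeff_msupp.
rewrite mcoeffB {1}[p]mpolyE !raddf_sum /=.
rewrite (bigID (fun m : 'X_{1..2} => `[< D (m ord0 + m ord_max + d)%N >])) /=.
rewrite sumrN addrAC subrr add0r big1 // => m' nD.
rewrite mcoeffZ mcoeffX; case: (m' =P m) => [Em|]; last by rewrite mulr0.
by case/asboolP: nD; rewrite Em.
Qed.
 
Lemma xy_span n p : reducing n -> ideal_pow I n.+1 p ->
  exists s t, [/\ ideal_pow I n s, ideal_pow I n t & p = xd * s + yd * t].
Proof.
move=> /spans_reducing/ideal_pow_spans; rewrite -[1]/('X^0) => H.
rewrite H; [|exact/inF_Xn/sumset_d|exact/inF_Xn/sumset_0].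
rewrite !homogenize_Xn // subnn subn0.
move=> /(ideal_mul_gen2 (ideal_pow_ideal I n))[s [t [Is It ->]]].
by exists t, s; rewrite addrC.
Qed.

(** The monomial has the least degree occurring in I^(n+1), so that its coefficient
    is unaffected by the maximal ideal: the statement serves both algebras. *)
Lemma xy_not_span n : ~ reducing n -> exists al be,
  [/\ in_pow n.+1 al be, (al + be = n.+1 * d)%N &
   forall s t, ideal_pow I n s -> ideal_pow I n t ->
     ('X_[mxy al be] - (xd * s + yd * t))@_(mxy al be) != 0].
Proof.
move=> /existsNP[s /not_implyP[sn /not_orP[sN sN']]].
have sd := sumset_le sn; exists (n.+1 * d - s)%N, s.
split; [exact: in_pow_sumset|by rewrite subnK|].
move=> f g /ideal_powP If /ideal_powP Ig; apply/negP.
rewrite mcoeffB mcoeffX eqxx subr_eq0 mcoeffD [xd * f]mulrC [yd * g]mulrC => /eqP E.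
have [f0|/coefM_monomial[m /If fm Em]] := eqVneq (f * xd)@_(mxy (n.+1 * d - s) s) 0.
  have : (g * yd)@_(mxy (n.+1 * d - s) s) != 0.
    by move: E; rewrite f0 add0r => <-; apply: oner_neq0.
  move=> /coefM_monomial[m /Ig gm Em].
  have /= := congr1 (fun m : 'X_{1..2} => m ord0) Em.
  have /= := congr1 (fun m : 'X_{1..2} => m ord_max) Em.
  rewrite mnmD_mxy0 mnmD_mxy1 mxy0 mxy1 addn0 => E1 E0; apply: sN'.
  exists (m ord_max); last by [].
  by apply: (in_pow_eq (_ : m ord0 + m ord_max = n * d)%N gm); lia.
have /= := congr1 (fun m : 'X_{1..2} => m ord0) Em.
have /= := congr1 (fun m : 'X_{1..2} => m ord_max) Em.
rewrite mnmD_mxy0 mnmD_mxy1 mxy0 mxy1 addn0 => E1 E0; apply: sN.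
by rewrite E1; apply: (in_pow_eq (_ : m ord0 + m ord_max = n * d)%N fm); lia.
Qed.

Local Notation u := (rees_mono xd_pow).
Local Notation v := (rees_mono yd_pow).

Lemma tofrac_inj (D : idomainType) : injective (@tofrac D).
Proof. by move=> x y /eqP; rewrite tofrac_eq => /eqP. Qed.

Lemma mxyX_neq0 al be : 'X_[mxy al be] != 0 :> A.
Proof.
apply/eqP => /(congr1 (mcoeff (mxy al be))); rewrite mcoeffX eqxx mcoeff0.
by apply/eqP; apply: oner_neq0.
Qed.

Lemma rees_generating_family :
  exists m (f : 'I_m -> rees I), @degree1_generators (rees_algebra I) m f.
Proof.
(* Exponents j which are not generators of I get the zero element. *)
have /choice[f fP] : forall j : 'I_d.+1, exists p : rees I,
    rees_deg 1 p /\ (sumset 1 j -> rees_poly p = 'X_[mxy (d - j) j] *: 'X^1).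
  move=> j; have [sj|nsj] := pselect (sumset 1 j).
    have Ij : ideal_pow I 1 'X_[mxy (d - j) j].
      by apply: ideal_pow_monomial; have := in_pow_sumset sj; rewrite mul1n.
    by exists (rees_mono Ij); split=> //; apply: rees_mono_deg.
  by exists 0; split=> //; exists 0; rewrite raddf0 scale0r.
exists d.+1, f; apply: (rees_generators erefl) => [j|x Sx]; first by case: (fP j).
have [s [s1 ->]] : exists s, sumset 1 s /\ x = 'X_[mxy (d - s) s].
  case: Sx => [[->|->]|[s sab <-]].
  - by exists 0%N; split; [exact: sumset_0|rewrite mpolyXxy subn0 expr0 mulr1].
  - by exists d; split; [exact: sumset_d|rewrite mpolyXxy subnn expr0 mul1r].
  - by exists s; split; [exact: sumset_mid|rewrite mpolyXxy].
have sd : (s < d.+1)%N by have := sumset_le s1; rewrite mul1n.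
by exists (Ordinal sd); have [_ ->] := fP (Ordinal sd).
Qed.

Section Regularity.
Variable r : nat.
Hypotheses (r_red : reducing r) (r_min : forall n, reducing n -> (r <= n)%N).
Hypothesis r_gt0 : (0 < r)%N.

Lemma not_reducing_pred : ~ reducing r.-1.
Proof. by move=> /r_min; rewrite leqNgt ltn_predL r_gt0. Qed.

Lemma rees_regularity : regularity (rees_algebra I) r%:Z.
Proof.
pose phi : {rmorphism rees I -> {fraction {poly A}}} := @tofrac {poly A} \o @rees_poly A I.
have phi_inj : injective phi by move=> p q /(@tofrac_inj {poly A})/val_inj.
have neq0 al be (h : ideal_pow I 1 'X_[mxy al be]) : rees_mono h != 0.
  apply/eqP => /(congr1 (fun p : rees I => (rees_poly p)`_1)).
  by rewrite coef_rees_mono raddf0 coef0 eqxx; apply/eqP/mxyX_neq0.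
apply: (@regularity_of_parameters (rees_algebra I) _ phi phi_inj u v r) => //.
- exact: rees_mono_deg.
- exact: rees_mono_deg.
- move=> n _ _ /rees_degP[x [Ix ->]] /rees_degP[y [Iy ->]] E.
  have {}E : x * yd - y * xd = 0.
    apply/eqP; rewrite subr_eq0; apply/eqP.
    have := congr1 (fun p : rees I => (rees_poly p)`_(n.+1 + 1)) E.
    by rewrite !rmorphM /= -!scalerAl -!scalerAr !scalerA -!exprD !coefZ !coefXn eqxx !mulr1.
  have [|w Iw Ew] := xy_descent (D := fun=> True) Ix Iy.
    by move=> m _; rewrite E mcoeff0.
  exists (rees_mono Iw); first exact: rees_mono_deg.
  apply: val_inj; rewrite rmorphM /= -scalerAl -scalerAr scalerA -exprD add1n.
  congr (_ *: _); apply/eqP; rewrite -subr_eq0; apply/eqP/mpolyP => m.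
  by rewrite Ew // mcoeff0.
- move=> n _ rn /rees_degP[x [Ix ->]].
  have [s [t [Is It E]]] := xy_span (reducing_le rn r_red) Ix.
  exists (rees_mono Is), (rees_mono It); split; try exact: rees_mono_deg.
  have -> : rees_mono Ix = u * rees_mono Is + v * rees_mono It.
    by rewrite !rees_monoM rees_monoD; apply: rees_mono_inj.
  by [].
- have [al [be [Im _ N]]] := xy_not_span not_reducing_pred.
  rewrite prednK // in Im; exists (rees_mono (ideal_pow_monomial Im)).
    exact: rees_mono_deg.
  move=> _ _ /rees_degP[s [Is ->]] /rees_degP[t [It ->]] E.
  have {}E : rees_mono (ideal_pow_monomial Im) = u * rees_mono Is + v * rees_mono It by [].
  have := congr1 (fun p : rees I => (rees_poly p)`_r) E.
  rewrite !rees_monoM rees_monoD !coef_rees_mono add1n (prednK r_gt0) eqxx => E'.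
  by have := N _ _ Is It; rewrite E' subrr mcoeff0 eqxx.
- exact: rees_generating_family.
Qed.

(** Keeping in degree n only the forms of degree nd, and dehomogenizing them,
    identifies the fiber ring with a subring of k[T][t]. *)
Definition fiber_dehom (p : rees I) : {poly {poly k}} :=
  \poly_(n < size (rees_poly p)) dehom (n * d) (rees_poly p)`_n.

Lemma coef_fiber_dehom (p : rees I) n : (fiber_dehom p)`_n = dehom (n * d) (rees_poly p)`_n.
Proof. by rewrite coef_poly; case: ltnP => // h; rewrite nth_default // raddf0. Qed.

Lemma fiber_dehomB (p q : rees I) : fiber_dehom (p - q) = fiber_dehom p - fiber_dehom q.
Proof. by apply/polyP => n; rewrite coefB !coef_fiber_dehom raddfB coefB raddfB. Qed.

Lemma fiber_dehomM (p q : rees I) : fiber_dehom (p * q) = fiber_dehom p * fiber_dehom q.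
Proof.
apply/polyP => n; rewrite coefM coef_fiber_dehom rmorphM coefM raddf_sum /=.
apply: eq_bigr => i _; rewrite !coef_fiber_dehom.
have {1}-> : (n * d = i * d + (n - i) * d)%N by rewrite -mulnDl subnKC // -ltnS.
by apply: dehom_lowM => e; apply: dehom_pow_low; apply: reesP.
Qed.

Lemma fiber_dehom1 : fiber_dehom 1 = 1.
Proof.
apply/polyP => n; rewrite coef_fiber_dehom rmorph1 !coef1.
by case: n => [|n]; rewrite ?raddf0 // mul0n /dehom rmorph1 coef1.
Qed.

Lemma fiber_dehom_eq0 (p : rees I) : fiber_dehom p = 0 <-> p \in @fiber_pred k I.
Proof.
split=> [E|/asboolP H].
  apply/asboolP => n; apply/max_ideal_powP => m pm.
  have Im : in_pow n (m ord0) (m ord_max) by have /ideal_powP := reesP p n; apply.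
  split=> //; rewrite ltn_neqAle (in_pow_ge Im) andbT; apply: contra pm => /eqP Em.
  have := congr1 (fun g : {poly {poly k}} => g`_n`_(m ord_max)) E.
  rewrite /= coef_fiber_dehom !coef0 dehom_coef Em leq_addl addnK -mxyE.
  by move=> ->.
apply/polyP => n; rewrite coef_fiber_dehom coef0; apply/polyP => s.
rewrite dehom_coef coef0; case: leqP => // sn; apply/eqP/negPn/negP.
move=> nz; have [_] := (max_ideal_powP _ _).1 (H n) _ nz.
by rewrite mxy0 mxy1 subnK // ltnn.
Qed.

Definition fiber_embed (x : fiber I) : {poly {poly k}} := fiber_dehom (repr x).

Lemma fiber_embedE (p : rees I) : fiber_embed (fiber_proj p) = fiber_dehom p.
Proof.
apply/eqP; rewrite -subr_eq0 -fiber_dehomB; apply/eqP/fiber_dehom_eq0.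
by apply/fiber_proj_eq; rewrite /fiber_proj reprK.
Qed.

Lemma fiber_embed_zmod : zmod_morphism fiber_embed.
Proof.
move=> x y; have [p ->] := fiber_proj_surj x; have [q ->] := fiber_proj_surj y.
by rewrite -raddfB /= !fiber_embedE fiber_dehomB.
Qed.

Lemma fiber_embed_monoid : monoid_morphism fiber_embed.
Proof.
split; first by rewrite -(rmorph1 (@fiber_proj k I)) fiber_embedE fiber_dehom1.
move=> x y; have [p ->] := fiber_proj_surj x; have [q ->] := fiber_proj_surj y.
by rewrite -rmorphM /= !fiber_embedE fiber_dehomM.
Qed.

Lemma fiber_embed_inj : injective fiber_embed.
Proof.
move=> x y; have [p ->] := fiber_proj_surj x; have [q ->] := fiber_proj_surj y.
rewrite !fiber_embedE => E; apply/fiber_proj_eq/fiber_dehom_eq0.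
by rewrite fiber_dehomB E subrr.
Qed.

Lemma fiber_degP n (x : fiber I) : fiber_deg n x ->
  exists z (Iz : ideal_pow I n z), x = fiber_proj (rees_mono Iz).
Proof. by move=> [p /rees_degP[z [Iz ->]] <-]; exists z, Iz. Qed.

Lemma fiber_mono_eq n z z' (Iz : ideal_pow I n z) (Iz' : ideal_pow I n z') :
  fiber_proj (rees_mono Iz) = fiber_proj (rees_mono Iz') <->
  ideal_mul (@max_ideal k) (ideal_pow I n) (z - z').
Proof.
split=> [/fiber_proj_eq/asboolP/(_ n)|H].
  by rewrite raddfB coefB !coef_rees_mono eqxx.
apply/fiber_proj_eq/asboolP => i; rewrite raddfB coefB !coef_rees_mono.
by case: (i =P n) => [->|_] //; rewrite subrr; case: (ideal_gen_ideal
   [set x * y | x in @max_ideal k & y in ideal_pow I i]%classic).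
Qed.

Lemma fiber_regularity : regularity (fiber_ring I) r%:Z.
Proof.
pose emb : {rmorphism fiber I -> {poly {poly k}}} := HB.pack fiber_embed
  (GRing.isZmodMorphism.Build _ _ fiber_embed fiber_embed_zmod)
  (GRing.isMonoidMorphism.Build _ _ fiber_embed fiber_embed_monoid).
pose phi : {rmorphism fiber I -> {fraction {poly {poly k}}}} := @tofrac {poly {poly k}} \o emb.
have phi_inj : injective phi.
  by move=> p q /(@tofrac_inj {poly {poly k}}) /fiber_embed_inj.
have neq0 al be (h : ideal_pow I 1 'X_[mxy al be]) : (al + be = d)%N -> fiber_proj (rees_mono h) != 0.
  move=> E; apply/eqP => /fiber_proj_eq0/asboolP/(_ 1%N).
  rewrite coef_rees_mono eqxx => /max_ideal_powP/(_ (mxy al be)).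
  by rewrite mcoeffX eqxx mxy0 mxy1 E mul1n ltnn => /(_ (oner_neq0 _))[].
have monoM m n x y (Ix : ideal_pow I m x) (Iy : ideal_pow I n y) :
    fiber_proj (rees_mono Ix) * fiber_proj (rees_mono Iy) = fiber_proj (rees_mono (ideal_powM Ix Iy)).
  by rewrite -rmorphM rees_monoM.
have monoD n x y (Ix : ideal_pow I n x) (Iy : ideal_pow I n y) :
    fiber_proj (rees_mono Ix) + fiber_proj (rees_mono Iy) = fiber_proj (rees_mono (ideal_powD Ix Iy)).
  by rewrite -raddfD rees_monoD.
apply: (@regularity_of_parameters (fiber_ring I) _ phi phi_inj (fiber_proj u) (fiber_proj v) r) => //.
- by exists u => //; apply: rees_mono_deg.
- by exists v => //; apply: rees_mono_deg.
- by apply: neq0; rewrite addn0.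
- exact: neq0.
- move=> n _ _ /fiber_degP[x [Ix ->]] /fiber_degP[y [Iy ->]].
  rewrite !monoM => /fiber_mono_eq/max_ideal_powP E.
  (* Modulo the maximal ideal only the least degree is visible. *)
  have [|w Iw Ew] := xy_descent (D := fun e => (e <= (n.+1 + 1) * d)%N) Ix Iy.
    by move=> m le; apply/eqP/negPn/negP => /E[_]; rewrite ltnNge le.
  exists (fiber_proj (rees_mono Iw)); first by exists (rees_mono Iw) => //; apply: rees_mono_deg.
  have Iw' : ideal_pow I n.+1 (xd * w) := ideal_powM xd_pow Iw.
  transitivity (fiber_proj (rees_mono Iw')).
    apply/fiber_mono_eq/max_ideal_powP => m h; split; last first.
      by rewrite ltnNge; apply: contra h => le; rewrite Ew // mulnDl mul1n leq_add2r.
    by have /ideal_powP := idealB (ideal_pow_ideal I n.+1) Ix Iw'; apply.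
  by rewrite monoM; congr fiber_proj; apply: val_inj.
- move=> n _ rn /fiber_degP[x [Ix ->]].
  have [s [t [Is It E]]] := xy_span (reducing_le rn r_red) Ix.
  exists (fiber_proj (rees_mono Is)), (fiber_proj (rees_mono It)); split.
  + by exists (rees_mono Is) => //; apply: rees_mono_deg.
  + by exists (rees_mono It) => //; apply: rees_mono_deg.
  + rewrite !monoM; have -> : rees_mono Ix = rees_mono (ideal_powD (ideal_powM xd_pow Is) (ideal_powM yd_pow It)).
      exact: rees_mono_inj.
    by rewrite -monoD.
- have [al [be [Im deg N]]] := xy_not_span not_reducing_pred.
  rewrite prednK // in Im deg; exists (fiber_proj (rees_mono (ideal_pow_monomial Im))).
    by exists (rees_mono (ideal_pow_monomial Im)) => //; apply: rees_mono_deg.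
  move=> _ _ /fiber_degP[s [Is ->]] /fiber_degP[t [It ->]].
  rewrite !monoM monoD => /fiber_proj_eq/asboolP/(_ r).
  rewrite raddfB coefB !coef_rees_mono add1n (prednK r_gt0) eqxx.
  move=> /max_ideal_powP/(_ _ (N _ _ Is It))[_].
  by rewrite mxy0 mxy1 deg ltnn.
- have [m [f fG]] := rees_generating_family.
  by exists m, (fun j => fiber_proj (f j)); apply: fiber_generators.
Qed.

End Regularity.

(** * Homogeneous minimal reductions *)

Definition combination (V : set {poly k}) n (h : {poly k}) :=
  exists l : seq ({poly k} * {poly k}),
    (forall w, w \in l -> V w.1 /\ inF n w.2) /\ h = \sum_(w <- l) w.1 * w.2.

Lemma inF_const g : (size g <= 1)%N -> inF 0 g.
Proof.
move=> g1 [|s]; first by move=> _; apply: sumset_0.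
by rewrite nth_default ?eqxx //; apply: leq_trans g1 _.
Qed.

Lemma homogenize_dehom e e' p : p \is e'.-homog ->
  homogenize e (dehom e p) = if e == e' then p else 0.
Proof.
move=> pe; apply/mpolyP => m; rewrite mcoeff_homogenize.
have pm0 : (m ord0 + m ord_max)%N != e' -> p@_m = 0.
  have <- : mdeg m = (m ord0 + m ord_max)%N.
    by rewrite mdegE big_ord_recl big_ord1 /=; congr (_ + m _)%N; apply: val_inj.
  exact: (dhomog_nemf_coeff pe).
case: (_ =P e) => [E|E].
  rewrite dehom_coef -{1 2}E leq_addl addnK -mxyE; case: (e =P e') => // ne.
  by rewrite pm0 ?mcoeff0 // E; apply/eqP.
case: (e =P e') => [ee|]; last by rewrite mcoeff0.
by rewrite pm0 // -ee; apply/eqP.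
Qed.

Section HomogeneousReduction.
Variable J : set A.
Hypotheses (J_homog : homogeneous_ideal J) (J_red : reduction J I).

Definition degree_part : set {poly k} := [set dehom d p | p in J]%classic.

Lemma J_ideal : is_ideal J. Proof. by case: J_red. Qed.

Lemma J_sub p : J p -> ideal_pow I 1 p.
Proof. by case: J_red => _ JI _ /JI; rewrite ideal_pow1. Qed.

Lemma degree_partP f : degree_part f -> inF 1 f.
Proof. by move=> [p /J_sub/dehom_pow + <-]; rewrite mul1n. Qed.

Lemma degree_part0 : degree_part 0.
Proof. by exists 0; [case: J_ideal|rewrite raddf0]. Qed.

Lemma degree_partD f g : degree_part f -> degree_part g -> degree_part (f + g).
Proof.
move=> [p Jp <-] [q Jq <-]; exists (p + q); last by rewrite raddfD.
by case: J_ideal => _ aJ _; apply: aJ.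
Qed.

Lemma degree_partZ (c : k) f : degree_part f -> degree_part (c *: f).
Proof.
move=> [p Jp <-]; exists (c%:MP * p); first by case: J_ideal => _ _; apply.
apply/polyP => s; rewrite coefZ !dehom_coef; case: ifP => _; rewrite ?mulr0 //.
by rewrite mcoeffCM.
Qed.

(** As J lies in degrees at least d, the component of degree d of c q, for q in J, is
    that of q times the constant term of c. *)
Lemma degree_part_homogenize f : degree_part f -> J (homogenize d f).
Proof.
move=> [p Jp <-]; case: J_homog => S Sh defJ; have [J0 aJ mJ] := J_ideal.
have hom0 : homogenize d 0 = 0 :> A.
  by apply/mpolyP => m; rewrite mcoeff_homogenize coef0 mcoeff0; case: ifP.
suff : (J `<=` [set p | J p /\ J (homogenize d (dehom d p))])%classic by move=> /(_ _ Jp)[].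
rewrite {1}defJ; apply: ideal_gen_min; first split => /=.
- by rewrite raddf0 hom0.
- move=> q q' [Jq hq] [Jq' hq']; rewrite raddfD homogenizeD.
  by split; apply: aJ.
- move=> c q [Jq hq]; split; first exact: mJ.
  rewrite -[d]add0n (@dehom_lowM _ 0 d) //; last first.
    by move=> e ed; apply: dehom_pow_low (J_sub Jq) _; rewrite mul1n.
  by rewrite homogenizeM ?size_dehom //; apply: mJ.
move=> q Sq; have Jq : J q by rewrite defJ; apply: ideal_gen_sub.
split=> //; have [e qe] := Sh q Sq.
by rewrite (homogenize_dehom d qe); case: ifP.
Qed.

(** For degree reasons, only forms of degree d in J and of degree nd in I^n can
    contribute. *)
Lemma dehom_mul_combination n p : ideal_mul J (ideal_pow I n) p ->
  combination degree_part n (dehom (n.+1 * d) p).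
Proof.
suff : (ideal_mul J (ideal_pow I n) `<=`
  [set p | ideal_pow I n.+1 p /\ combination degree_part n (dehom (n.+1 * d) p)])%classic.
  by move=> H /H[].
have [I0 aI mI] := ideal_pow_ideal I n.+1.
apply: ideal_gen_min; first split => /=.
- by split=> //; exists [::]; rewrite big_nil raddf0.
- move=> q q' [Iq [l [lP El]]] [Iq' [l' [lP' El']]]; split; first exact: aI.
  exists (l ++ l'); split; last by rewrite big_cat raddfD /= El El'.
  by move=> w; rewrite mem_cat => /orP[/lP|/lP'].
- move=> c q [Iq [l [lP El]]]; split; first exact: mI.
  exists [seq (w.1, dehom 0 c * w.2) | w <- l]; split.
    move=> _ /mapP[w /lP[w1 w2] ->]; split=> //=.
    by rewrite -[n]add0n; apply: inFM => //; apply/inF_const/size_dehom.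
  rewrite big_map /= -[(n.+1 * d)%N]add0n (@dehom_lowM _ 0 (n.+1 * d)) //; last first.
    by move=> e; apply: dehom_pow_low.
  by rewrite El mulr_sumr; apply: eq_bigr => w _; rewrite mulrCA.
move=> _ [q Jq [q' Iq' <-]]; split.
  exact: (ideal_powM (J_sub Jq) Iq').
exists [:: (dehom d q, dehom (n * d) q')]; split.
  by move=> w; rewrite inE => /eqP -> /=; split; [exists q|apply: dehom_pow].
rewrite big_seq1 mulSn dehom_lowM // => e; last exact: dehom_pow_low.
by move=> ed; apply: dehom_pow_low (J_sub Jq) _; rewrite mul1n.
Qed.

Lemma reduction_combination : exists n,
  combination degree_part n 1 /\ combination degree_part n 'X^(n.+1 * d).
Proof.
case: J_red => _ _ [n E]; exists n.
have H s : sumset n.+1 s -> combination degree_part n 'X^s.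
  move=> sn; have := homogenize_pow (inF_Xn sn); rewrite E.
  move/dehom_mul_combination; rewrite dehom_homogenize ?eqxx //.
  by apply: inF_size; apply: inF_Xn.
split; first exact: (H _ (sumset_0 _)).
by apply: H; exists n.+1, 0%N, 0%N; split; lia.
Qed.

(** Otherwise x divides every form of degree d in J, and y^((n+1)d) does not lie in
    J I^n. *)
Lemma exists_degree_d : exists2 f, degree_part f & f`_d != 0.
Proof.
have [n [_ [l [lP El]]]] := reduction_combination.
apply: contrapT => none.
have small w : w \in l -> (size w.1 <= d)%N.
  move=> /lP[w1 _]; apply/leq_sizeP => s ds.
  have [->|sd] := eqVneq s d.
    by apply/eqP/negPn/negP => h; apply: none; exists w.1.
  have := inF_size (degree_partP w1); rewrite mul1n => /leq_sizeP; apply.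
  by rewrite ltn_neqAle eq_sym sd.
have : (size ('X^(n.+1 * d) : {poly k})%R <= n.+1 * d)%N.
  rewrite El big_seq; apply: (big_ind (fun g : {poly k} => size g <= n.+1 * d)%N) => [||w wl].
  - by rewrite size_poly0.
  - by move=> g g' h h'; apply: leq_trans (size_polyD _ _) _; rewrite geq_max h h'.
  - have [_ /inF_size h2] := lP w wl; have h1 := small w wl.
    apply: leq_trans (size_polyMleq _ _) _; rewrite mulSn.
    move: h1 h2; move: (size w.1) (size w.2) (n * d)%N => i j ?; lia.
by rewrite size_polyXn ltnn.
Qed.

(** Common divisors of [degree_part] divide 1. As k is infinite, a general element
    of it is coprime to a given one. *)
Lemma parameters_in_reduction : infinite_set [set: k] ->
  exists f g, [/\ degree_part f, degree_part g & parameters f g].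
Proof.
move=> k_inf; have [f Vf fd] := exists_degree_d.
have f0 : f != 0 by apply: contraNneq fd => ->; rewrite coef0.
have [n [[l [lP El]] _]] := reduction_combination.
have [||//|w|g Vg gl] := coprime_in_subspace k_inf _ _ _ f0 (V := degree_part) (l := unzip1 l).
- exact: degree_partD.
- exact: degree_partZ.
- exact: degree_part0.
- by move=> /mapP[w' /lP[Vw _] ->].
exists f, g; split=> //; split=> //; [exact: degree_partP|exact: degree_partP|].
rewrite /coprimep -dvdp1 [X in _ %| X]El big_seq.
apply: (big_ind (fun h : {poly k} => gcdp f g %| h)) => [|h h'|w wl].
- exact: dvdp0.
- exact: dvdp_add.
by apply: dvdp_mulr; apply: gl; apply: map_f.
Qed.

End HomogeneousReduction.

(** Two coprime forms of degree d in J generate a reduction, which is J by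
    minimality. *)
Lemma minimal_reduction_reducing (J : set A) n : infinite_set [set: k] ->
  homogeneous_ideal J -> minimal_reduction J I ->
  ideal_pow I n.+1 = ideal_mul J (ideal_pow I n) <-> reducing n.
Proof.
move=> k_inf Jh [Jred Jmin].
have [f [g [Vf Vg fg]]] := parameters_in_reduction Jred k_inf.
pose K := ideal_gen [set homogenize d f; homogenize d g]%classic.
have [f1 g1 _ _] := fg.
have KE m : ideal_pow I m.+1 = ideal_mul K (ideal_pow I m) <-> reducing m.
  by apply: iff_trans (ideal_pow_spans m f1 g1) _; apply: spans_parameters.
have KJ : (K `<=` J)%classic.
  apply: ideal_gen_min; first by case: Jred.
  by move=> _ [->|->]; apply: degree_part_homogenize.
have [_ JI _] := Jred.
have <- : K = J.
  apply: Jmin => //; split; first exact: ideal_gen_ideal.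
    by move=> p /KJ/JI.
  by exists d; apply/KE/reducing_d.
exact: KE.
Qed.

End MonomialIdeal.

Local Open Scope classical_set_scope.

Theorem theorem4p2 (k : fieldType) (k_infinite : infinite_set [set: k])
    (a b d : nat) (a_gt0 : (0 < a)%N) (le_ab : (a <= b)%N) (lt_bd : (b < d)%N)
    (I : set {mpoly k[2]}) (defI : I = monomial_ideal d a b)
    (J : set {mpoly k[2]}) :
  homogeneous_ideal J -> minimal_reduction J I ->
  exists r : nat,
    [/\ reduction_number J I r,
        regularity (rees_algebra I) r%:Z
      & regularity (fiber_ring I) r%:Z].
Proof.
subst I => J_homog J_min.
have exr : exists n, `[< reducing a b d n >].
  by exists d; apply/asboolP; apply: reducing_d.
case: (ex_minnP exr) => r /asboolP r_red r_min.
have {}r_min n : reducing a b d n -> (r <= n)%N by move=> h; apply/r_min/asboolP.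
have r_gt0 : (0 < r)%N.
  by rewrite lt0n; apply/eqP => r0; apply: (not_reducing0 a_gt0 le_ab lt_bd); rewrite -r0.
have JE n := minimal_reduction_reducing a_gt0 le_ab lt_bd n k_infinite J_homog J_min.
exists r; split; [|exact: rees_regularity|exact: fiber_regularity].
by split=> [|n /JE/r_min //]; apply/JE.
Qed.
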